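(* Let $X$ be a Kaplansky module over $C(K)$, let $U$ be a $d$-isomorphism of $X$ with $\sigma(U)\subseteq\mathbb{T}$ (the unit circle), let $w\in C(K)$ and $T=wU$. Let $\varphi$ be the homeomorphism of $K$ corresponding to the automorphism $f\mapsto UfU^{-1}$ of $C(K)$, i.e. $UfU^{-1}=f\circ\varphi$. Assume that the set of all $\varphi$-periodic points in $K$ is empty and that $K$ has no isolated points. Consider the operator $\tilde T=wU^{-1}$. Then $$\sigma_2(T')=\sigma_{a.p.}(\tilde T).$$
   Context: All spaces are over $\mathbb{C}$; $L(X)$ is the algebra of bounded linear operators on $X$; $T'$ is the conjugate operator. Banach $C(K)$-module: $K$ is a compact Hausdorff space, $X$ a Banach space, $m:C(K)\to L(X)$ a bounded unital homomorphism. It is always assumed that $m$ is injective and isometric and that $m(C(K))$ is closed in $L(X)$ in the weak operator topology; $f\in C(K)$ is identified with $m(f)$. For $x\in X$ the cyclic subspace $X(x)=\mathrm{cl}\{fx: f\in C(K)\}$, with the norm of $X$ and the cone $X_+(x)=\mathrm{cl}\{fx: f\in C(K), f\ge0\}$, is a (complex) Banach lattice. $X$ is a Kaplansky module if $K$ is extremally disconnected and for every $x$ the set $\{f\in C(K): fx=0\}$ is a band in $C(K)$. $d$-endomorphism: $T\in L(X)$ such that for every $x\in X$, $T(X(x))\subseteq X(Tx)$ and $T|X(x):X(x)\to X(Tx)$ is disjointness preserving ($u\perp v\Rightarrow Tu\perp Tv$). A $d$-isomorphism is an invertible $d$-endomorphism whose inverse is also a $d$-endomorphism. A point $k$ is $\varphi$-periodic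 if $\varphi^m(k)=k$ for some $m\in\mathbb{N}$. $\sigma_{a.p.}(A)=\{\lambda\in\mathbb{C}:\exists x_n,\ \|x_n\|=1,\ Ax_n-\lambda x_n\to0\}$. $\sigma_2(A)$ is the set of $\lambda\in\mathbb{C}$ for which $\lambda I-A$ does not have both closed range and finite-dimensional kernel; thus $\sigma_2(T')$ equals the set of $\lambda$ for which $\lambda I-T$ is not lower semi-Fredholm (closed range of finite codimension). *)

(* Defs.v *)
From HB Require Import structures.
From mathcomp Require Import all_boot all_order all_algebra.
From mathcomp Require Import all_classical all_reals topology normedtype.
From mathcomp Require Import complex.

Set Implicit Arguments.
Unset Strict Implicit.
Unset Printing Implicit Defensive.

Import Order.TTheory GRing.Theory Num.Theory.
Import numFieldNormedType.Exports.

Local Open Scope classical_set_scope.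
Local Open Scope ring_scope.

Section ContinuousFunctions.
Context {F : numFieldType} {K : topologicalType}.

Definition cts_pred : {pred K -> F^o} := mem [set f | continuous f].
Definition cts_key : pred_key cts_pred. Proof. exact. Qed.
Canonical cts_keyed := KeyedPred cts_key.

Lemma cts_subring : subring_closed cts_pred.
Proof.
split.
- by rewrite inE => x; exact: cvg_cst.
- by move=> f g /[!inE] cf cg x; apply: cvgB; [exact: cf|exact: cg].
- by move=> f g /[!inE] cf cg x; apply: cvgM; [exact: cf|exact: cg].
Qed.

Lemma cts_submod : submod_closed cts_pred.
Proof.
split; first by rewrite inE => x; exact: cvg_cst.
move=> a f g /[!inE] cf cg x; apply: cvgD; last exact: cg.
by apply: cvgZl_tmp; exact: cf.
Qed.

HB.instance Definition _ :=
  GRing.isSubringClosed.Build (K -> F^o) cts_pred cts_subring.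
HB.instance Definition _ :=
  GRing.isSubmodClosed.Build F (K -> F^o) cts_pred cts_submod.

Section Sub.
Context (f : K -> F^o) (fP : f \in cts_pred).
Definition cts_Sub_subproof := @isContinuous.Build _ _ f (set_mem fP).
#[local] HB.instance Definition _ := cts_Sub_subproof.
Definition cts_Sub : continuousType K F^o := f.
End Sub.

Lemma cts_rect (P : continuousType K F^o -> Type) :
  (forall f (Pf : f \in cts_pred), P (cts_Sub Pf)) -> forall u, P u.
Proof.
move=> Psub [f [[Pf]]]/=.
by suff -> : Pf = (set_mem (@mem_set _ [set f | _] f Pf)) by apply: Psub.
Qed.

Lemma cts_valP f (Pf : f \in cts_pred) : cts_Sub Pf = f :> (_ -> _).
Proof. by []. Qed.

HB.instance Definition _ :=
  isSub.Build _ _ (continuousType K F^o) cts_rect cts_valP.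
HB.instance Definition _ :=
  GRing.SubChoice_isSubComPzRing.Build _ _ (continuousType K F^o) cts_subring.
HB.instance Definition _ :=
  [SubZmodule_isSubLmodule of continuousType K F^o by <:].
End ContinuousFunctions.

Section BoundedOperators.
Context {F : numFieldType}.
Implicit Types V W : normedModType F.

Definition bop_pred V W : {pred V -> W} :=
  mem [set f | linear f /\ continuous f].

Record bop V W := Bop { bop_fun :> V -> W ; _ : bop_fun \in @bop_pred V W }.

HB.instance Definition _ V W := [isSub for @bop_fun V W].
HB.instance Definition _ V W := [Choice of bop V W by <:].

Lemma bop_linear V W (A : bop V W) : linear A.
Proof. by case: A => A /= /[!inE] -[]. Qed.

HB.instance Definition _ V W (A : bop V W) :=
  GRing.isLinear.Build F V W _ (bop_fun A) (bop_linear A).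

Lemma bop_continuous V W (A : bop V W) : continuous A.
Proof. by case: A => A /= /[!inE] -[]. Qed.

Lemma bopP V W (A B : bop V W) : A =1 B -> A = B.
Proof. by move=> AB; apply/val_inj/funext. Qed.

Lemma bop_submod V W : submod_closed (@bop_pred V W).
Proof.
split.
  rewrite inE; split=> [a u v|x]; last exact: cvg_cst.
  by rewrite /= scaler0 addr0.
move=> a f g /[!inE] -[lf cf] [lg cg]; split=> [b u v|x].
  rewrite !fctE lf lg !scalerDr !scalerA [a * b]mulrC.
  by rewrite -!addrA; congr (_ + _); rewrite addrCA.
by apply: cvgD; [apply: cvgZl_tmp; exact: cf|exact: cg].
Qed.

HB.instance Definition _ V W :=
  GRing.isSubmodClosed.Build F (V -> W) (@bop_pred V W) (@bop_submod V W).
HB.instance Definition _ V W := [SubChoice_isSubLmodule of bop V W by <:].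

Lemma bop_id_subproof V : (@idfun V) \in @bop_pred V V.
Proof. by rewrite inE; split=> // x. Qed.
Definition bop_id V : bop V V := Bop (bop_id_subproof V).

Lemma bop_comp_subproof V1 V2 V3 (A : bop V2 V3) (B : bop V1 V2) :
  (A \o B) \in @bop_pred V1 V3.
Proof.
rewrite inE; split=> [a u v|x]; first by rewrite /= !linearP.
by apply: continuous_comp; exact: bop_continuous.
Qed.
Definition bop_comp V1 V2 V3 (A : bop V2 V3) (B : bop V1 V2) : bop V1 V3 :=
  Bop (bop_comp_subproof A B).

Section ring.
Context {V : normedModType F}.
Implicit Types A B D : bop V V.
Let compA : associative (@bop_comp V V V).
Proof. by move=> A B D; exact: bopP. Qed.
Let comp1b : left_id (bop_id V) (@bop_comp V V V).
Proof. by move=> A; exact: bopP. Qed.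
Let compb1 : right_id (bop_id V) (@bop_comp V V V).
Proof. by move=> A; exact: bopP. Qed.
Let compDl : left_distributive (@bop_comp V V V) +%R.
Proof. by move=> A B D; exact: bopP. Qed.
Let compDr : right_distributive (@bop_comp V V V) +%R.
Proof. by move=> A B D; apply: bopP => x; exact: (linearD A (B x) (D x)). Qed.
HB.instance Definition _ :=
  GRing.Zmodule_isPzRing.Build (bop V V) compA comp1b compb1 compDl compDr.
End ring.
End BoundedOperators.

Notation "''L' ( V , W )" := (bop V W)
  (at level 8, format "''L' ( V ,  W )") : type_scope.
Notation "''L' ( V )" := (bop V V)
  (at level 8, format "''L' ( V )") : type_scope.

Section OperatorNorm.
Context {R : realType}.
Implicit Types V W : normedModType R[i].
Local Open Scope complex_scope.

Definition bop_norms V W (A : 'L(V, W)) : set R :=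
  [set complex.Re `|A x| | x in [set x : V | `|x| <= 1]].

Definition bop_norm V W (A : 'L(V, W)) : R[i] := (sup (bop_norms A))%:C.

Lemma normE V (x : V) : `|x| = (complex.Re `|x|)%:C.
Proof. by rewrite RRe_real// normr_real. Qed.

Lemma bop_normsP V W (A : 'L(V, W)) : has_sup (bop_norms A).
Proof.
split; first by exists (complex.Re `|A 0|), 0; rewrite //= normr0.
have /linear_boundedP : bounded_near A (nbhs (0 : V)).
  by apply/linear_bounded_continuous; exact: bop_continuous.
move=> /pinfty_ex_gt0[M M0 AM]; exists (complex.Re M) => _ [x /= x1 <-].
rewrite -lecR -normE RRe_real ?gtr0_real//.
by rewrite (le_trans (AM x))// -[leRHS]mulr1 ler_pM2l.
Qed.

Lemma bop_norm_ub V W (A : 'L(V, W)) x : `|x| <= 1 -> `|A x| <= bop_norm A.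
Proof.
move=> x1; rewrite normE lecR.
by apply: (ub_le_sup (bop_normsP A).2); exists x.
Qed.

Lemma bop_norm_le V W (A : 'L(V, W)) (M : R[i]) :
  M \is Num.real ->
  (forall x, `|x| <= 1 -> `|A x| <= M) -> bop_norm A <= M.
Proof.
move=> Mr AM; rewrite -[M]RRe_real// lecR.
apply: ge_sup; first exact: (bop_normsP A).1.
by move=> _ [x /= x1 <-]; rewrite -lecR -normE RRe_real//; exact: AM.
Qed.

Lemma bop_norm_real V W (A : 'L(V, W)) : bop_norm A \is Num.real.
Proof. by apply/complex_realP; eexists. Qed.

Lemma bop_normP V W (A : 'L(V, W)) x : `|A x| <= bop_norm A * `|x|.
Proof.
have [->|x0] := eqVneq x 0; first by rewrite linear0 !normr0 mulr0.
have xp : 0 < `|x| by rewrite normr_gt0.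
have -> : x = `|x| *: (`|x|^-1 *: x).
  by rewrite scalerA divff ?scale1r ?normr_eq0.
rewrite linearZ/= !normrZ normr_id mulrCA ler_pM2l//.
rewrite normfV normr_id mulVf ?normr_eq0// mulr1.
by apply: bop_norm_ub; rewrite normrZ normfV normr_id mulVf ?normr_eq0.
Qed.

Section norm.
Context {V W : normedModType R[i]}.
Implicit Types A B : 'L(V, W).

Let normD A B : bop_norm (A + B) <= bop_norm A + bop_norm B.
Proof.
apply: bop_norm_le; first by rewrite rpredD ?bop_norm_real.
move=> x x1; apply: le_trans (ler_normD (A x) (B x)) _.
by rewrite lerD ?bop_norm_ub.
Qed.

Let normZle (a : R[i]) A : bop_norm (a *: A) <= `|a| * bop_norm A.
Proof.
apply: bop_norm_le; first by rewrite rpredM ?bop_norm_real ?normr_real.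
move=> x x1; rewrite [X in `|X|](_ : _ = a *: A x)// normrZ.
by rewrite ler_wpM2l ?bop_norm_ub.
Qed.

Let normZ (a : R[i]) A : bop_norm (a *: A) = `|a| * bop_norm A.
Proof.
have [->|a0] := eqVneq a 0.
  rewrite normr0 mul0r; apply/eqP; rewrite eq_le; apply/andP; split.
    by have := normZle 0 A; rewrite normr0 mul0r.
  by apply: le_trans (bop_norm_ub (0 *: A) (x := 0) _); rewrite ?normr0.
apply/eqP; rewrite eq_le normZle/=.
have := normZle a^-1 (a *: A); rewrite scalerA mulVf// scale1r normfV.
by rewrite ler_pdivlMl ?normr_gt0.
Qed.

Let norm_eq0 A : bop_norm A = 0 -> A = 0.
Proof.
move=> A0; apply: bopP => x; apply/eqP; rewrite -normr_le0.
by apply: le_trans (bop_normP A x) _; rewrite A0 mul0r.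
Qed.

HB.instance Definition _ :=
  Lmodule_isNormed.Build R[i] 'L(V, W) normD normZ norm_eq0.
End norm.
End OperatorNorm.

Section Dual.
Context {R : realType}.
Implicit Types V W : normedModType R[i].

Definition dual V : normedModType R[i] := 'L(V, R[i]^o).

Definition adjoint_fun V W (A : 'L(V, W)) (g : dual W) : dual V := bop_comp g A.

Lemma adjoint_subproof V W (A : 'L(V, W)) :
  adjoint_fun A \in @bop_pred _ (dual W) (dual V).
Proof.
have lA : linear (adjoint_fun A) by move=> a g h; exact: bopP.
pose B := GRing.isLinear.Build R[i] (dual W) (dual V) _ (adjoint_fun A) lA.
pose A' : {linear dual W -> dual V} := HB.pack (adjoint_fun A) B.
rewrite inE; split => //; apply: (@bounded_linear_continuous _ _ _ A').
apply/linear_boundedP; near=> r => g.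
have rA : bop_norm A <= r by near: r; apply: nbhs_pinfty_ge; exact: bop_norm_real.
apply: bop_norm_le => [|x x1].
  by rewrite rpredM ?normr_real//; near: r; exact: nbhs_pinfty_real.
have Ax : `|A x| <= r by exact: le_trans (bop_norm_ub A x1) rA.
apply: le_trans (bop_normP g (A x)) _.
by rewrite [leRHS]mulrC; apply: ler_wpM2l Ax; exact: (normr_ge0 g).
Unshelve. all: by end_near. Qed.

Definition adjoint V W (A : 'L(V, W)) : 'L(dual W, dual V) :=
  Bop (adjoint_subproof A).
End Dual.

Section Spectra.
Context {R : realType} {V : normedModType R[i]}.
Implicit Types A B : 'L(V).

Definition spectrum A : set R[i] :=
  [set l | ~ exists B, B * (l *: (1 : 'L(V)) - A) = 1 /\ (l *: (1 : 'L(V)) - A) * B = 1].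

Definition sigma_ap A : set R[i] :=
  [set l | exists x : nat -> V, (forall n, `|x n| = 1) /\
     (A (x n) - l *: x n) @[n --> \oo] --> (0 : V)].

Definition finite_dimensional (S : set V) : Prop :=
  exists n (e : 'I_n -> V),
    S = [set \sum_(i < n) c i *: e i | c in [set: 'I_n -> R[i]]].

Definition sigma2 A : set R[i] :=
  [set l | ~ (closed (range (l *: (1 : 'L(V)) - A)) /\
              finite_dimensional [set x | (l *: (1 : 'L(V)) - A) x = 0])].
End Spectra.

(* A |-> (g (A x))_(x, g), with values in a product of copies of C indexed by
   the vectors x and the functionals g. *)
Definition weak_operator_topology {R : realType} (V W : normedModType R[i]) :
    topologicalType :=
  initial_topology ((fun A p => p.2 (A p.1)) :
    'L(V, W) -> {ptws V * dual W -> R[i]^o}).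

Section ContinuousFunctionLattice.
Context {R : realType} {K : topologicalType}.
Local Notation CK := (continuousType K R[i]^o).
Implicit Types (f g s : CK) (B D : set CK).
Local Open Scope complex_scope.

Definition sup_norm f : R := sup [set complex.Re `|f k| | k in [set: K]].

Definition cts_comp f (phi : continuousType K K) : CK := f \o phi.

Definition cts_ge0 f : Prop := forall k, (0 : R[i]) <= f k.

Definition cts_real f : Prop := forall k, (f k : R[i]) \is Num.real.

Definition cts_le f g : Prop := forall k, (f k : R[i]) <= g k.

Definition cts_is_sup D s : Prop :=
  [/\ cts_real s, forall f, D f -> cts_le f s &
      forall g, cts_real g -> (forall f, D f -> cts_le f g) -> cts_le s g].

(* Suprema are taken in the real vector lattice of real-valued elements of CK;
   solidity uses the modulus of complex-valued functions. *)
Definition is_band B : Prop :=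
  [/\ B 0 /\ (forall (a : R[i]) f g, B f -> B g -> B (a *: f + g)),
      forall f g, (forall k, `|g k| <= `|f k|) -> B f -> B g &
      forall D s, D `<=` B -> D `<=` cts_real -> cts_is_sup D s -> B s].
End ContinuousFunctionLattice.

Definition extremally_disconnected (K : topologicalType) : Prop :=
  forall O : set K, open O -> open (closure O).

(* Modulus and disjointness in the complex Banach lattice with positive cone P:
   its real part is P - P, ordered by P, and for u = a + ib with a, b real,
   |u| is the supremum over t of (cos t) a + (sin t) b; z below stands for
   cos t + i sin t. *)
Section ComplexLattice.
Context {R : realType} {X : normedModType R[i]}.
Implicit Types (P : set X) (u v s t r : X).
Local Open Scope complex_scope.

Definition real_part P : set X := [set a - b | a in P & b in P].

Definition cone_le P u v : Prop := P (v - u).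

Definition is_modulus P u s : Prop :=
  exists a b, [/\ real_part P a, real_part P b & u = a + 'i *: b] /\
    let rot (z : R[i]) := (complex.Re z)%:C *: a + (complex.Im z)%:C *: b in
    [/\ real_part P s, forall z, `|z| = 1 -> cone_le P (rot z) s &
        forall r, real_part P r ->
          (forall z, `|z| = 1 -> cone_le P (rot z) r) -> cone_le P s r].

Definition is_inf P s t r : Prop :=
  [/\ real_part P r, cone_le P r s, cone_le P r t &
      forall q, real_part P q -> cone_le P q s -> cone_le P q t -> cone_le P q r].

Definition lattice_disjoint P u v : Prop :=
  exists s t, [/\ is_modulus P u s, is_modulus P v t & is_inf P s t 0].
End ComplexLattice.

Section BanachModules.
Context {R : realType} {K : topologicalType} {X : normedModType R[i]}.
Local Notation CK := (continuousType K R[i]^o).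
Variable m : {linear CK -> 'L(X)}.
Implicit Types (T U : 'L(X)) (x : X).
Local Open Scope complex_scope.

(* Boundedness of m is not listed: module_isometric implies it. *)
Record Banach_CK_module : Prop := {
  module_compact : compact [set: K] ;
  module_hausdorff : hausdorff_space K ;
  module_morphism : GRing.monoid_morphism m ;
  module_injective : injective m ;
  module_isometric : forall f, `|m f| = (sup_norm f)%:C ;
  module_wot_closed : closed (range m : set (weak_operator_topology X X))
}.

Record Kaplansky_module : Prop := {
  Kaplansky_Banach_CK_module : Banach_CK_module ;
  Kaplansky_extremally_disconnected : extremally_disconnected K ;
  Kaplansky_band : forall x, is_band [set f | m f x = 0]
}.

Definition cyclic_subspace x : set X := closure [set m f x | f in [set: CK]].

Definition cyclic_cone x : set X := closure [set m f x | f in cts_ge0].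

Definition d_endomorphism T : Prop :=
  forall x, T @` cyclic_subspace x `<=` cyclic_subspace (T x) /\
    forall u v, cyclic_subspace x u -> cyclic_subspace x v ->
      lattice_disjoint (cyclic_cone x) u v ->
      lattice_disjoint (cyclic_cone (T x)) (T u) (T v).

Definition d_isomorphism T : Prop :=
  d_endomorphism T /\ exists U, [/\ U * T = 1, T * U = 1 & d_endomorphism U].
End BanachModules.

Definition homeomorphism (K : topologicalType) (phi : K -> K) : Prop :=
  continuous phi /\
  exists psi : K -> K, [/\ continuous psi, cancel phi psi & cancel psi phi].

Definition periodic_points (K : Type) (phi : K -> K) : set K :=
  [set k | exists2 n, (0 < n)%N & iter n phi k = k].

(* Main.v *)
(* Both spectra turn out to be the same set of l: those for which some point k
   satisfies |w_n(k)| <= |l|^n <= |w_n(phi^-n(k))| for all n, where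
   w_n = w (w o phi) ... (w o phi^(n-1)).
   The dual X' with U' and the module X with U^-1 are two instances of one
   situation: a module over C(K) and an invertible V such that f V = V (f o phi)
   and the norms of the powers of V and V^-1 grow subexponentially, which is all
   that is used of sigma(U) being contained in the unit circle. Let S = V w.
   If such a k exists, sums of c_j l^-j S^j z with z supported near phi^-N(k) and
   with slowly varying c_j peaked at j = N are almost eigenvectors of S. As K has
   no isolated points and phi no periodic ones, arbitrarily many of them have
   disjoint supports, so l - S cannot have closed range and finite-dimensional
   kernel.
   If there is no such k, then along each orbit the products of the weight grow
   by a fixed factor after boundedly many steps in one of the two directions. For
   large n this splits K into two clopen sets, on which |w_n| is large, resp.
   |w_n o phi^-n| is small, compared with the norms of V^n and V^-n, and comparing
   y with (S/l)^n y on each of them shows that l - S is bounded below. *)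
Require Import Defs.
From HB Require Import structures.
From mathcomp Require Import all_boot all_order all_algebra.
From mathcomp Require Import all_classical all_reals topology normedtype.
From mathcomp Require Import complex ring lra zify.

Set Implicit Arguments.
Unset Strict Implicit.
Unset Printing Implicit Defensive.

Import Order.TTheory GRing.Theory Num.Theory.
Import numFieldNormedType.Exports.

Local Open Scope classical_set_scope.
Local Open Scope ring_scope.

(** The same [phi] serves both sides because adjoints reverse products: [U m(f) = m(f o phi) U]
    becomes [m(f)' U' = U' m(f o phi)'], which has the shape of [m(f) U^-1 = U^-1 m(f o phi)]. Only
    the place of the weight differs: [T' = U' w'], while [w U^-1 = U^-1 (w o phi)]; passing from [w]
    to [w o phi] just moves the base point of the orbit. Subexponential growth is the spectral
    radius formula. It is derived from the mere existence of resolvents: averages over roots of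
    unity replace the contour integral. The obstacle in the wave packets is that long sums have to
    be estimated with constants independent of the number of terms. Changing the coefficients of a
    packet is therefore realised as multiplication by one continuous function, built on a tower of
    disjoint clopen sets, whose norm is a supremum and not a sum. Almost eigenvectors contradict a
    closed range with finite-dimensional kernel only after preimages of controlled norm are
    available, whence an open mapping argument; on the dual it rests on a direct proof of
    completeness. *)

Section RealNorm.
Context {R : realType}.
Implicit Types V W : normedModType R[i].
Local Open Scope complex_scope.

(** Norms take values in [R[i]], whose order is partial; [nr] and, for scalars, [nrc] bring them to
    the ordered field [R], where suprema and [lra] apply. *)
Definition nr V (x : V) : R := complex.Re `|x|.

Definition nrc (a : R[i]) : R := complex.Re `|a|.

Lemma nrE V (x : V) : `|x| = (nr x)%:C.
Proof. exact: normE. Qed.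

Lemma nrcE (a : R[i]) : `|a| = (nrc a)%:C.
Proof. by rewrite /nrc RRe_real//; exact: normr_real. Qed.

Lemma nr_ge0 V (x : V) : 0 <= nr x.
Proof. by rewrite -lecR -nrE; exact: normr_ge0. Qed.

Lemma nrc_ge0 (a : R[i]) : 0 <= nrc a.
Proof. by rewrite -lecR -nrcE; exact: normr_ge0. Qed.

Lemma nr0 V : nr (0 : V) = 0.
Proof. by rewrite /nr normr0. Qed.

Lemma nrN V (x : V) : nr (- x) = nr x.
Proof. by rewrite /nr normrN. Qed.

Lemma nrB V (x y : V) : nr (x - y) = nr (y - x).
Proof. by rewrite -nrN opprB. Qed.

Lemma nr0_eq0 V (x : V) : nr x = 0 -> x = 0.
Proof. by move=> x0; apply/normr0_eq0; rewrite nrE x0. Qed.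

Lemma nr_gt0 V (x : V) : x <> 0 -> 0 < nr x.
Proof.
move=> x0; rewrite lt0r nr_ge0 andbT; apply/eqP => x0'.
by apply: x0; exact: nr0_eq0.
Qed.

Lemma nrD V (x y : V) : nr (x + y) <= nr x + nr y.
Proof. by rewrite -lecR rmorphD/= -!nrE ler_normD. Qed.

Lemma nrD_le V (x y : V) a b : nr x <= a -> nr y <= b -> nr (x + y) <= a + b.
Proof. by move=> xa yb; apply: (le_trans (nrD x y)); rewrite lerD. Qed.

Lemma nr_sum V (I : Type) (s : seq I) (P : pred I) (F : I -> V) :
  nr (\sum_(i <- s | P i) F i) <= \sum_(i <- s | P i) nr (F i).
Proof.
elim/big_ind2 : _ => //; first by rewrite nr0.
by move=> *; exact: nrD_le.
Qed.

Lemma nrZ V (a : R[i]) (x : V) : nr (a *: x) = nrc a * nr x.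
Proof. by apply/complexI; rewrite rmorphM/= -!nrE -nrcE normrZ. Qed.

Lemma nrcM a b : nrc (a * b) = nrc a * nrc b.
Proof. by apply/complexI; rewrite rmorphM/= -!nrcE normrM. Qed.

Lemma nrcX a n : nrc (a ^+ n) = nrc a ^+ n.
Proof. by apply/complexI; rewrite rmorphXn/= -!nrcE normrX. Qed.

Lemma nrcV a : nrc a^-1 = (nrc a)^-1.
Proof. by apply/complexI; rewrite fmorphV/= -!nrcE normfV. Qed.

Lemma nrcD a b : nrc (a + b) <= nrc a + nrc b.
Proof. by rewrite -lecR rmorphD/= -!nrcE ler_normD. Qed.

Lemma nrcN a : nrc (- a) = nrc a.
Proof. by rewrite /nrc normrN. Qed.

Lemma nrc0 : nrc 0 = 0.
Proof. by rewrite /nrc normr0. Qed.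

Lemma nrc1 : nrc 1 = 1.
Proof. by rewrite /nrc normr1. Qed.

Lemma nrcR (x : R) : nrc x%:C = `|x|.
Proof. by apply/complexI; rewrite -nrcE normc_def/= expr0n addr0 sqrtr_sqr. Qed.

Lemma nrc_eq0 a : (nrc a == 0) = (a == 0).
Proof. by rewrite -(inj_eq (@complexI R)) -nrcE normr_eq0. Qed.

Lemma nrci : nrc 'i = 1.
Proof. by apply/complexI; rewrite -nrcE normc_def/= expr0n add0r expr1n sqrtr1. Qed.

Lemma nrc_ReIm a : nrc a <= `|complex.Re a| + `|complex.Im a|.
Proof.
rewrite {1}[a]complexE; apply: le_trans (nrcD _ _) _.
by rewrite nrcM !nrcR nrci mul1r.
Qed.

Lemma nrc_ge_Re a : `|complex.Re a| <= nrc a.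
Proof. by rewrite -lecR -nrcE normc_ge_Re. Qed.

Lemma nrc_ge_Im a : `|complex.Im a| <= nrc a.
Proof.
rewrite -(normrN (complex.Im a)) -ReiNIm (le_trans (nrc_ge_Re _))//.
by rewrite nrcM nrci mulr1.
Qed.

Lemma nr_le V (x : V) (c : R) : (nr x <= c) = (`|x| <= c%:C).
Proof. by rewrite nrE lecR. Qed.

Lemma nrc_le a (c : R) : (nrc a <= c) = (`|a| <= c%:C).
Proof. by rewrite nrcE lecR. Qed.

Lemma nr_regular (a : R[i]^o) : nr a = nrc a.
Proof. by []. Qed.

Lemma bop_nr V W (A : 'L(V, W)) x : nr (A x) <= nr A * nr x.
Proof. by rewrite -lecR rmorphM/= -!nrE; exact: bop_normP. Qed.

Lemma bop_nr_le V W (A : 'L(V, W)) (c : R) : 0 <= c ->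
  (forall x, nr (A x) <= c * nr x) -> nr A <= c.
Proof.
move=> c0 Ac; rewrite nr_le; apply: bop_norm_le => [|x x1].
  by apply/complex_realP; exists c.
rewrite -nr_le; apply: (le_trans (Ac x)).
by rewrite -[leRHS]mulr1 ler_wpM2l// nr_le.
Qed.

Lemma nr_bopM V (A B : 'L(V)) : nr (A * B) <= nr A * nr B.
Proof.
apply: bop_nr_le => [|x]; first by rewrite mulr_ge0 ?nr_ge0.
apply: (le_trans (bop_nr A (B x))).
by rewrite -mulrA ler_wpM2l ?nr_ge0 ?bop_nr.
Qed.

Lemma nr_bop1 V : nr (1 : 'L(V)) <= 1.
Proof. by apply: bop_nr_le => // x; rewrite mul1r. Qed.

Lemma nr_bopX V (A : 'L(V)) n : nr (A ^+ n) <= nr A ^+ n.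
Proof.
elim: n => [|n IH]; first by rewrite expr0 nr_bop1.
by rewrite !exprS (le_trans (nr_bopM _ _))// ler_wpM2l ?nr_ge0.
Qed.

Lemma bop_scalel V (a : R[i]) (A B : 'L(V)) : (a *: A) * B = a *: (A * B).
Proof. exact: bopP. Qed.

Lemma bop_scaler V (a : R[i]) (A B : 'L(V)) : A * (a *: B) = a *: (A * B).
Proof. by apply: bopP => x; rewrite /= linearZ. Qed.

Lemma bopMx V (A B : 'L(V)) x : (A * B) x = A (B x).
Proof. by []. Qed.

Lemma bopZx V W a (A : 'L(V, W)) x : (a *: A) x = a *: A x.
Proof. by []. Qed.

Lemma bop_sub V W (A : 'L(V, W)) x y : A (x - y) = A x - A y.
Proof. exact: linearB. Qed.

Lemma bop_smul V W (A : 'L(V, W)) a x : A (a *: x) = a *: A x.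
Proof. exact: linearZ. Qed.

End RealNorm.

(** * Geometric growth and decay of real powers *)

Section Powers.
Context {R : realType}.
Implicit Types (x q e M rho : R).

Lemma bernoulli x n : -1 <= x -> 1 + n%:R * x <= (1 + x) ^+ n.
Proof.
move=> x1; elim: n => [|n IH]; first by rewrite mul0r addr0 expr0.
rewrite exprS; apply: le_trans (_ : (1 + x) * (1 + n%:R * x) <= _).
  rewrite -natr1; have : 0 <= n%:R * x ^+ 2 by rewrite mulr_ge0 ?sqr_ge0.
  lra.
by rewrite ler_wpM2l//; lra.
Qed.

Lemma pow_large rho M : 1 < rho -> exists n0, forall n, (n0 <= n)%N -> M < rho ^+ n.
Proof.
move=> rho1; have r0 : 0 < rho - 1 by rewrite subr_gt0.
have [n0 Mn0] : exists n0 : nat, M / (rho - 1) < n0%:R.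
  by exists (Num.bound `|M / (rho - 1)|);
    exact: le_lt_trans (ler_norm _) (archi_boundP (normr_ge0 _)).
exists n0 => n n0n; rewrite -[rho](subrK 1) addrC.
apply: lt_le_trans (bernoulli _ _); last by lra.
move: Mn0; rewrite ltr_pdivrMr// => /lt_le_trans; apply.
have : n0%:R * (rho - 1) <= n%:R * (rho - 1) by rewrite ler_wpM2r ?ler_nat// ltW.
lra.
Qed.

Lemma pow_small q e : 0 <= q -> q < 1 -> 0 < e ->
  exists n0, forall n, (n0 <= n)%N -> q ^+ n < e.
Proof.
move=> q0 q1 e0; have [->|qn0] := eqVneq q 0.
  by exists 1%N => -[|n]// _; rewrite expr0n.
have qp : 0 < q by rewrite lt0r qn0.
have [|n0 H] := @pow_large q^-1 e^-1; first by rewrite invf_gt1.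
exists n0 => n /H; rewrite exprVn ltf_pV2 ?posrE//.
by rewrite exprn_gt0.
Qed.

End Powers.

(** * Spectral radius: growth of powers from the resolvent *)

Section SpectralRadius.
Context {R : realType} {V : normedModType R[i]} (A : 'L(V)).
Local Open Scope complex_scope.
Implicit Types (z : R[i]) (r s t : R).

Definition inverse_bop (B D : 'L(V)) := B * D = 1 /\ D * B = 1.

(** Partial fractions: [(1 - B)^-1 + (1 + B)^-1 = 2 (1 - B^2)^-1]. This is the doubling step of the
    roots-of-unity average. *)
Lemma inverse_bop_mean (B G H : 'L(V)) :
  inverse_bop G (1 - B) -> inverse_bop H (1 + B) ->
  inverse_bop (2^-1 *: (G + H)) (1 - B * B).
Proof.
have fac1 : 1 - B * B = (1 - B) * (1 + B).
  by rewrite mulrDr mulr1 mulrBl mul1r addrA subrK.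
have fac2 : 1 - B * B = (1 + B) * (1 - B).
  by rewrite mulrBr mulr1 mulrDl mul1r opprD addrA addrK.
have half : 2^-1 *: ((1 + B) + (1 - B)) = 1 :> 'L(V).
  have -> : (1 + B) + (1 - B) = 2 *: (1 : 'L(V)).
    by rewrite addrACA subrr addr0 scaler_nat mulr2n.
  by rewrite scalerA mulVf ?scale1r// pnatr_eq0.
move=> [G1 G2] [H1 H2]; split.
  rewrite bop_scalel mulrDl {1}fac1 fac2 !mulrA G1 H1 !mul1r; exact: half.
rewrite bop_scaler mulrDr {1}fac2 fac1 -!mulrA G2 H2 !mulr1; exact: half.
Qed.

Section Dyadic.
Variables (r : R) (Rs : R[i] -> 'L(V)).
Hypothesis RsP : forall z, nrc z <= r -> inverse_bop (Rs z) (1 - z *: A).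

(** Unfolded, this is the mean of [Rs] over the points [zeta z], with [zeta] running through the
    roots of unity of order [2^k]: a discrete Cauchy integral. The factor inserted at each level
    flips the sign of [z ^ (2^k)]. *)
Fixpoint dyadic_inverse k z : 'L(V) :=
  if k is k'.+1 then 2^-1 *: (dyadic_inverse k' z +
                              dyadic_inverse k' ((2 ^ k').-root (-1) * z))
  else Rs z.

Let rootE k : ((2 ^ k).-root (-1) : R[i]) ^+ (2 ^ k) = -1.
Proof. by rewrite rootCK// expn_gt0. Qed.

Let nrc_root k : nrc ((2 ^ k).-root (-1) : R[i]) = 1.
Proof.
apply: (@pexpIrn _ (2 ^ k)%N); rewrite ?expn_gt0 ?nnegrE ?nrc_ge0//.
by rewrite -nrcX rootE nrcN nrc1 expr1n.
Qed.

Lemma dyadic_inverseP k z : nrc z <= r ->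
  inverse_bop (dyadic_inverse k z) (1 - z ^+ (2 ^ k) *: A ^+ (2 ^ k)).
Proof.
elim: k z => [|k IH] z zr; first by rewrite expn0 !expr1; exact: RsP.
have := IH _ zr; have := IH ((2 ^ k).-root (-1) * z).
rewrite nrcM nrc_root mul1r => /(_ zr).
rewrite exprMn rootE mulN1r scaleNr opprK => H1 H2.
have := inverse_bop_mean H2 H1.
by rewrite bop_scalel bop_scaler scalerA -!exprD addnn -mul2n -expnS.
Qed.

(** A mean of differences obeys the bound of its terms. That [e] does not depend on [k] allows the
    power to be chosen afterwards. *)
Lemma dyadic_inverse_dist t (e : R) :
  (forall z, nrc z <= r -> nr (Rs (t%:C * z) - Rs z) <= e) ->
  forall k z, nrc z <= r ->
    nr (dyadic_inverse k (t%:C * z) - dyadic_inverse k z) <= e.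
Proof.
move=> H; elim=> [|k IH] z zr; first exact: H.
rewrite /= -scalerBr nrZ nrcV (_ : nrc 2 = 2).
  2: by have := nrcR (2 : R); rewrite rmorph_nat ger0_norm.
rewrite mulrC ler_pdivrMr// opprD addrACA mulrDr mulr1.
apply: nrD_le; first exact: IH.
by rewrite mulrCA; apply: IH; rewrite nrcM nrc_root mul1r.
Qed.

End Dyadic.

Definition small_power s := exists k, s ^+ (2 ^ k) * nr (A ^+ (2 ^ k)) < 1.

(** By submultiplicativity, passing to a further dyadic power raises the small quantity itself to
    that power. *)
Lemma small_power_lt s (e : R) : 0 <= s -> 0 < e -> small_power s ->
  exists k, s ^+ (2 ^ k) * nr (A ^+ (2 ^ k)) < e.
Proof.
move=> s0 e0 [k sk]; set q := _ * _ in sk.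
have q0 : 0 <= q by rewrite mulr_ge0 ?exprn_ge0 ?nr_ge0.
have [n0 Hn] := pow_small q0 sk e0; exists (k + n0)%N.
apply: le_lt_trans (Hn (2 ^ n0)%N (ltnW (ltn_expl _ _)))=> //.
rewrite /q expnD exprM exprMn exprM ler_wpM2l ?exprn_ge0//.
exact: nr_bopX.
Qed.

(* The resolvents at s and t^-1 s being close uniformly along the dyadic powers,
   smallness of the powers propagates from radius s to radius t^-1 s. *)
Lemma small_power_step r (Rs : R[i] -> 'L(V)) t s : 0 < t -> t <= 1 -> 0 <= s ->
  (forall z, nrc z <= r -> inverse_bop (Rs z) (1 - z *: A)) ->
  (forall z, nrc z <= r -> nr (Rs (t%:C * z) - Rs z) <= 4^-1) ->
  s / t <= r -> small_power s -> small_power (s / t).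
Proof.
have aux (b : R) : b <= (1 + b) * 3^-1 -> b < 1 by lra.
(* With [20^-1] the inverse at [s] is within 1/19 of the identity. Adding the distance [4^-1] keeps
   the inverse at [s / t] within 1/3 of it, and [nr Bz <= (1 + nr Bz) / 3] then forces
   [nr Bz < 1]. *)
move=> t0 t1 s0 RsP Rs_dist sr /small_power_lt-/(_ 20^-1 s0).
rewrite invr_gt0 ltr0n => /(_ isT)[k sk]; exists k.
set n := (2 ^ k)%N in sk *; pose z := (s / t)%:C.
have st0 : 0 <= s / t by rewrite divr_ge0// ltW.
have zr : nrc z <= r by rewrite nrcR ger0_norm.
have tz : t%:C * z = s%:C by rewrite -rmorphM/= mulrC divfK// gt_eqF.
have sr' : nrc s%:C <= r.
  apply: le_trans zr; rewrite -tz nrcM ler_piMl ?nrc_ge0// nrcR.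
  by rewrite ger0_norm// ltW.
have [_ Fz] := dyadic_inverseP RsP k zr.
have [_ Fs] := dyadic_inverseP RsP k sr'.
have := dyadic_inverse_dist Rs_dist k zr; rewrite tz.
move: Fz Fs; set G := dyadic_inverse _ _ z; set H := dyadic_inverse _ _ _.
rewrite -/n; set Bz := _ *: _; set Bs := _ *: _ => Fz Fs GH.
have nBs : nr Bs < 20^-1 by rewrite nrZ nrcX nrcR ger0_norm.
have H1 : H - 1 = Bs * H by rewrite -Fs mulrBl mul1r subKr.
have nH : nr (H - 1) <= 20^-1 * (1 + nr (H - 1)).
  rewrite {1}H1; apply: le_trans (nr_bopM _ _) _.
  rewrite ler_pM ?nr_ge0 ?(ltW nBs)// -{1}[H](subrK 1) addrC.
  by apply: nrD_le => //; exact: nr_bop1.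
have nG : nr (G - 1) <= 3^-1.
  have -> : G - 1 = (G - H) + (H - 1) by rewrite addrA subrK.
  apply: le_trans (nrD_le (_ : _ <= 4^-1) (lexx _)) _; first by rewrite nrB.
  lra.
suff /aux : nr Bz <= (1 + nr Bz) * 3^-1 by rewrite nrZ nrcX nrcR ger0_norm.
have {1}-> : Bz = (1 - Bz) * (G - 1) by rewrite mulrBr mulr1 Fz subKr.
apply: le_trans (nr_bopM _ _) _; rewrite ler_pM ?nr_ge0//.
by apply: nrD_le; [exact: nr_bop1|rewrite nrN].
Qed.

Hypothesis resolvent : forall z, nrc z < 1 -> exists B, inverse_bop B (1 - z *: A).

(** The resolvent identity, with the unknown [nr (Rs z)] absorbed for [z] close to [z0]. The bound
    is half of [4^-1] because two such points are later compared through [z0]. *)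
Lemma resolvent_dist (Rs : R[i] -> 'L(V)) r z0 :
  (forall z, nrc z <= r -> inverse_bop (Rs z) (1 - z *: A)) -> nrc z0 <= r ->
  exists2 e : R, 0 < e &
    forall z, nrc z <= r -> nrc (z - z0) <= e -> nr (Rs z - Rs z0) <= 8^-1.
Proof.
move=> RsP z0r; pose c := nr A * nr (Rs z0).
have c0 : 0 <= c by rewrite mulr_ge0 ?nr_ge0.
pose M := 1 + nr (Rs z0).
have M0 : 1 <= M by rewrite lerDl nr_ge0.
exists (16^-1 / (1 + c) / M) => [|z zr zz0].
  by rewrite !divr_gt0//; lra.
have RR : Rs z - Rs z0 = (z - z0) *: (Rs z * (A * Rs z0)).
  have [Hz _] := RsP _ zr; have [_ Hz0] := RsP _ z0r.
  have -> : Rs z - Rs z0 = Rs z * ((1 - z0 *: A) - (1 - z *: A)) * Rs z0.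
    by rewrite mulrBr mulrBl Hz mul1r -mulrA Hz0 mulr1.
  rewrite (_ : _ - (1 - z *: A) = (z - z0) *: A) ?bop_scaler ?bop_scalel ?mulrA//.
  by rewrite opprB addrC addrA subrK scalerBl.
have zc : nrc (z - z0) * c <= 16^-1 / M.
  apply: le_trans (_ : 16^-1 / (1 + c) / M * c <= _).
    by rewrite ler_wpM2r.
  rewrite mulrAC ler_wpM2r ?invr_ge0 ?(le_trans ler01)//.
  rewrite mulrAC ler_pdivrMr ?ler_pM2l//; lra.
have d : nr (Rs z - Rs z0) <= nr (Rs z) * (16^-1 / M).
  rewrite RR nrZ mulrC; apply: le_trans (_ : nr (Rs z) * c * nrc (z - z0) <= _).
    rewrite ler_wpM2r ?nrc_ge0//; apply: le_trans (nr_bopM _ _) _.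
    by rewrite ler_wpM2l ?nr_ge0 ?nr_bopM.
  by rewrite -mulrA ler_wpM2l ?nr_ge0// mulrC.
have n1 : nr (Rs z) <= nr (Rs z0) + nr (Rs z) * (16^-1 / M).
  rewrite -{1}[Rs z](subrK (Rs z0)) addrC; exact: nrD_le.
have n2 : nr (Rs z) * (16^-1 / M) <= nr (Rs z) * 16^-1.
  by rewrite ler_wpM2l ?nr_ge0// ler_pdivrMr ?ler_peMr//; lra.
apply: (le_trans d); rewrite mulrA ler_pdivrMr; last lra.
by rewrite /M; have := nr_ge0 (Rs z); lra.
Qed.

(** Compactness of the square [[-1, 1]^2] yields one [t] for the whole disc. Points outside the disc
    satisfy [P] vacuously, and so do points near them. *)
Lemma resolvent_unif (Rs : R[i] -> 'L(V)) r : r < 1 ->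
  (forall z, nrc z <= r -> inverse_bop (Rs z) (1 - z *: A)) ->
  exists2 t : R, 0 < t < 1 &
    forall z, nrc z <= r -> nr (Rs (t%:C * z) - Rs z) <= 4^-1.
Proof.
have q84 : 8^-1 + 8^-1 <= 4^-1 :> R by lra.
move=> r1 RsP.
pose K : set (R * R) := `[-1, 1] `*` `[-1, 1].
have Kcomp : compact K by apply: compact_setX; exact: segment_compact.
pose zz (p : R * R) : R[i] := p.1 +i* p.2.
pose P t p := nrc (zz p) <= r -> nr (Rs (t%:C * zz p) - Rs (zz p)) <= 4^-1.
have zzB p p0 : nrc (zz p - zz p0) <= `|p.1 - p0.1| + `|p.2 - p0.2|.
  exact: le_trans (nrc_ReIm _) _.
have zzc (p0 : R * R) (e : R) : 0 < e -> \forall p \near p0, nrc (zz p - zz p0) <= e.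
  move=> e0; apply/nbhs_ballP; exists (e / 2) => /=; first by rewrite divr_gt0.
  move=> p [/= b1 b2]; apply: (le_trans (zzB _ _)).
  rewrite [leRHS](splitr e) lerD//.
    by rewrite distrC ltW.
  by rewrite distrC ltW.
have : \forall t \near (1 : R)^'-, K `<=` P t.
  move/compact_near_coveringP: Kcomp; apply => p0 _.
  have [p0r|p0r] := leP (nrc (zz p0)) r.
    have [e e0 H] := resolvent_dist RsP p0r.
    exists ([set p | nrc (zz p - zz p0) <= e / 2], [set t | 0 < t < 1 /\ 1 - t <= e / 2]).
      split=> /=; first by apply: zzc; rewrite divr_gt0.
      near=> t; split; last first.
        rewrite lerBlDr addrC -lerBlDr; near: t; apply: nbhs_left_ge.
        by rewrite ltrBlDr ltrDl divr_gt0.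
      apply/andP; split; last by near: t; exact: nbhs_left_lt.
      by near: t; apply: nbhs_left_gt.
    move=> [p t] [/= pp0 [/andP[t0 t1] te]]; rewrite /P/= => zpr.
    have ztr : nrc (t%:C * zz p) <= nrc (zz p).
      by rewrite nrcM ler_piMl ?nrc_ge0// nrcR ger0_norm ltW.
    have ztp : nrc (t%:C * zz p - zz p) <= e / 2.
      rewrite -[X in _ - X]mul1r -mulrBl nrcM -(rmorph1 (real_complex R)) -rmorphB/=.
      rewrite nrcR distrC ger0_norm ?subr_ge0 ?(ltW t1)//.
      apply: le_trans te; rewrite ler_piMr ?subr_ge0 ?(ltW t1)//.
      exact: ltW (le_lt_trans zpr r1).
    have h1 : nr (Rs (t%:C * zz p) - Rs (zz p0)) <= 8^-1.
      apply: H; first exact: le_trans ztr zpr.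
      rewrite -(subrK (zz p) (t%:C * _)) -addrA.
      by apply: le_trans (nrcD _ _) _; rewrite [leRHS](splitr e) lerD.
    have h2 : nr (Rs (zz p) - Rs (zz p0)) <= 8^-1.
      by apply: H => //; apply: le_trans pp0 _; rewrite ler_pdivrMr// ler_peMr// ?ler1n// ltW.
    rewrite -(subrK (Rs (zz p0)) (Rs (t%:C * _))) -addrA.
    apply: le_trans q84; apply: nrD_le h1 _; rewrite nrB; exact: h2.
  exists ([set p | nrc (zz p - zz p0) <= (nrc (zz p0) - r) / 2], setT).
    split=> /=; last exact: filterT.
    by apply: zzc; rewrite divr_gt0// subr_gt0.
  move=> [p t] [/= pp0 _]; rewrite /P/= => zpr.
  have : nrc (zz p0) <= nrc (zz p) + nrc (zz p - zz p0).
    by rewrite -[nrc (zz p - _)]nrcN opprB; apply: le_trans (nrcD _ _); rewrite addrC subrK.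
  move: p0r; lra.
move=> H; near ((1 : R)^'-) => t.
have Ht : K `<=` P t by near: t.
exists t.
  apply/andP; split; last by near: t; exact: nbhs_left_lt.
  by near: t; apply: nbhs_left_gt.
move=> z zr; have zE : zz (complex.Re z, complex.Im z) = z by case: (z).
have Ki x : `|x| <= nrc z -> `[-1, 1]%classic x.
  by move=> xz; rewrite /= in_itv/= -ler_norml; lra.
rewrite -zE; apply: Ht; last by rewrite zE.
by split; apply: Ki; [exact: nrc_ge_Re|exact: nrc_ge_Im].
Unshelve. all: by end_near. Qed.

Lemma small_powers r : 0 < r -> r < 1 -> small_power r.
Proof.
move=> r0 r1.
have /choice[Rs RsP] : forall z, exists B, nrc z <= r -> inverse_bop B (1 - z *: A).
  move=> z; have [zr|] := leP (nrc z) r; last by exists 1.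
  by have [B HB] := resolvent (le_lt_trans zr r1); exists B.
have [t /andP[t0 t1] Rs_dist] := resolvent_unif r1 RsP.
pose c := 1 + nr A; have c0 : 1 <= c by rewrite lerDl nr_ge0.
(* Since [nr A < t^-n0], the first power is already small at radius [t^n0 r]; [n0] divisions by [t]
   lead back to [r]. *)
have [n0 /(_ n0 (leqnn _)) tn0] : exists n0, forall n, (n0 <= n)%N -> t ^+ n < c^-1.
  by apply: pow_small; rewrite ?ltW// invr_gt0; lra.
have : small_power (t ^+ n0 * r).
  exists 0%N; rewrite expn0 !expr1.
  apply: le_lt_trans (_ : c^-1 * nr A < 1).
    rewrite ler_wpM2r ?nr_ge0//; apply: le_trans (ltW tn0).
    by rewrite ler_piMr ?exprn_ge0 ?ltW.
  by rewrite mulrC ltr_pdivrMr /c; have := nr_ge0 A; lra.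
elim: n0 {tn0} => [|n IH]; first by rewrite expr0 mul1r.
move=> /(small_power_step t0 (ltW t1) _ RsP Rs_dist).
have -> : t ^+ n.+1 * r / t = t ^+ n * r.
  by rewrite exprS [t * _]mulrC mulrAC mulrK// unitfE gt_eqF.
move=> H; apply/IH/H; first by rewrite mulr_ge0 ?exprn_ge0 ?ltW.
by rewrite ler_piMl ?exprn_ile1 ?ltW.
Qed.

(** Division with remainder by [n = 2^k]: each full block costs at most [rho^n], and the remainder
    contributes one of finitely many norms. *)
Lemma growth_bound (rho : R) : 1 < rho ->
  exists2 C : R, 0 < C & forall n, nr (A ^+ n) <= C * rho ^+ n.
Proof.
move=> rho1; have rho0 : 0 < rho by lra.
have [||k sk] := @small_powers rho^-1; rewrite ?invr_gt0 ?invf_lt1//.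
move: sk; set n := (2 ^ k)%N; have n0 : (0 < n)%N by rewrite expn_gt0.
rewrite exprVn mulrC ltr_pdivrMr ?exprn_gt0// mul1r => sk.
pose C := \sum_(i < n) nr (A ^+ i).
exists (1 + C) => [|j].
  by rewrite ltr_wpDr// sumr_ge0// => i _; exact: nr_ge0.
have Ci i : (i < n)%N -> nr (A ^+ i) <= C.
  move=> ilt; rewrite /C (bigD1 (Ordinal ilt))//= lerDl.
  by rewrite sumr_ge0// => k' _; exact: nr_ge0.
have C0 : 0 <= C by rewrite sumr_ge0// => i _; exact: nr_ge0.
have jn : nr (A ^+ (n * (j %/ n))) <= rho ^+ (n * (j %/ n)).
  rewrite !exprM; apply: le_trans (nr_bopX _ _) _.
  by rewrite lerXn2r ?nnegrE ?nr_ge0 ?exprn_ge0// ltW.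
rewrite (divn_eq j n) mulnC addnC !exprD; apply: le_trans (nr_bopM _ _) _.
rewrite mulrA ler_pM ?nr_ge0//.
apply: le_trans (Ci _ (ltn_pmod _ n0)) _.
have r1 : 1 <= rho ^+ (j %% n) by rewrite exprn_ege1// ltW.
by apply: le_trans (_ : (1 + C) * 1 <= _); rewrite ?ler_wpM2l//; lra.
Qed.

End SpectralRadius.

(** * Limits with explicit errors and completeness of the dual *)

Section BoundedMaps.
Context {R : realType}.
Local Open Scope complex_scope.

Lemma bounded_linear_bop (V W : normedModType R[i]) (f : V -> W) (c : R) :
  linear f -> (forall x, nr (f x) <= c * nr x) -> exists A : 'L(V, W), A =1 f.
Proof.
move=> lf fc.
pose B := GRing.isLinear.Build R[i] V W _ f lf.
pose f' : {linear V -> W} := HB.pack f B.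
suff fP : f \in @bop_pred _ V W by exists (Bop fP).
rewrite inE; split => //; apply: (@bounded_linear_continuous _ _ _ f').
apply/linear_boundedP; near=> r => x.
apply: (@le_trans _ _ (c * nr x)%:C); first by rewrite -nr_le; exact: fc.
rewrite rmorphM/= -nrE ler_wpM2r//.
by near: r; apply: nbhs_pinfty_ge; apply/complex_realP; exists c.
Unshelve. all: by end_near. Qed.

(** Arbitrarily small values are asked for, not convergence: a bound by [e n] for every [n] can
    exploit any single small one. *)
Definition vanishing (e : nat -> R) := forall d, 0 < d -> exists n, e n < d.

Lemma vanishing_eq0 (V : normedModType R[i]) (x : V) (e : nat -> R) (c : R) :
  0 <= c -> vanishing e -> (forall n, nr x <= e n * c) -> x = 0.
Proof.
move=> c0 e0 xe; apply/nr0_eq0/eqP; rewrite eq_le nr_ge0 andbT.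
apply/ler_addgt0Pl => d d0; rewrite addr0.
have c1 : 0 < c + 1 by lra.
have [n en] := e0 _ (divr_gt0 d0 c1).
apply: (le_trans (xe n)); apply: (@le_trans _ _ (d / (c + 1) * c)).
  by rewrite ler_wpM2r// ltW.
by rewrite mulrAC ler_pdivrMr// ler_pM2l//; lra.
Qed.

(** The intervals of radius [e i] about [u i] meet pairwise, so the supremum of their left ends lies
    in all of them. *)
Lemma real_seq_limit (u e : nat -> R) :
  (forall i j, `|u i - u j| <= e i + e j) -> exists l, forall i, `|u i - l| <= e i.
Proof.
move=> ue; pose S := range (fun i => u i - e i).
have SS : has_sup S.
  split; first by exists (u 0 - e 0), 0.
  exists (u 0 + e 0) => _ [i _ <-]; have := ue i 0; rewrite ler_norml; lra.
exists (sup S) => i; rewrite ler_norml; apply/andP; split.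
  suff : sup S <= u i + e i by lra.
  apply: ge_sup; first exact: SS.1.
  by move=> _ [j _ <-]; have := ue i j; rewrite ler_norml; lra.
suff : u i - e i <= sup S by lra.
by apply: ub_le_sup; [exact: SS.2|exists i].
Qed.

Lemma complex_seq_limit (u : nat -> R[i]) (e : nat -> R) :
  (forall i j, nrc (u i - u j) <= e i + e j) ->
  exists l, forall i, nrc (u i - l) <= e i * 2.
Proof.
move=> ue.
have [|a Ha] := @real_seq_limit (fun i => complex.Re (u i)) e.
  move=> i j; apply: le_trans (ue i j).
  by rewrite -raddfB; exact: nrc_ge_Re.
have [|b Hb] := @real_seq_limit (fun i => complex.Im (u i)) e.
  move=> i j; apply: le_trans (ue i j).
  by rewrite -raddfB; exact: nrc_ge_Im.
exists (a +i* b) => i; apply: le_trans (nrc_ReIm _) _.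
by have := Ha i; have := Hb i; case: (u i) => x y /=; lra.
Qed.

Lemma dual_complete (V : normedModType R[i]) (g : nat -> dual V) (e : nat -> R) :
  vanishing e -> (forall i j, nr (g i - g j) <= e i + e j) ->
  exists h : dual V, forall i, nr (g i - h) <= e i * 2.
Proof.
move=> e0 ge.
have e_ge0 i : 0 <= e i by have := ge i i; rewrite subrr nr0; lra.
have /choice[h Hh] : forall x, exists l : R[i]^o, forall i, nr (g i x - l) <= e i * 2 * nr x.
  move=> x; have [|l Hl] := @complex_seq_limit (fun i => g i x) (fun i => e i * nr x).
    move=> i j; rewrite -mulrDl; apply: le_trans (bop_nr (g i - g j) x) _.
    by rewrite ler_wpM2r ?nr_ge0.
  by exists l => i; rewrite mulrAC; exact: Hl.
have alg (p q r u v : R[i]^o) : p - (q + r) = - (u + v - p) + ((u - q) + (v - r)).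
  by rewrite (addrACA u) -(opprD q) opprB addrA subrK.
have lh : linear h.
  move=> a x y; apply/eqP; rewrite -subr_eq0; apply/eqP.
  pose c := 2 * (nr (a *: x + y) + nrc a * nr x + nr y).
  apply: (@vanishing_eq0 _ _ _ c) e0 _.
    by rewrite mulr_ge0// !addr_ge0 ?mulr_ge0 ?nr_ge0 ?nrc_ge0.
  move=> i.
  have -> : h (a *: x + y) - (a *: h x + h y) =
      - (g i (a *: x + y) - h (a *: x + y)) + (a *: (g i x - h x) + (g i y - h y)).
    by rewrite (linearP (g i)) (scalerBr a) -alg.
  have -> : e i * c = e i * 2 * nr (a *: x + y) + (nrc a * (e i * 2 * nr x) + e i * 2 * nr y).
    by rewrite /c; ring.
  apply: nrD_le; first by rewrite nrN.
  apply: nrD_le; last exact: Hh.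
  by rewrite nrZ ler_wpM2l ?nrc_ge0.
have [|H HH] := @bounded_linear_bop _ _ h (e 0 * 2 + nr (g 0)) lh.
  move=> x; rewrite mulrDl -[h x](subrK (g 0 x)).
  by apply: nrD_le; [rewrite nrB|exact: bop_nr].
exists H => i; apply: bop_nr_le => [|x]; first by rewrite mulr_ge0.
by rewrite [X in nr X](_ : _ = g i x - h x)// -HH.
Qed.

End BoundedMaps.

(** * The Hahn-Banach theorem *)

Section HahnBanach.
Context {R : realType} {V : normedModType R[i]}.
Local Open Scope complex_scope.
Implicit Types (G : set (V * R)) (x y z : V) (a b c r s : R).

(* The graph of a real-linear functional, dominated by the norm, on a
   real-linear subspace. *)
Definition dominated_graph G :=
  (forall c x r y s, G (x, r) -> G (y, s) -> G (c%:C *: x + y, c * r + s)) /\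
  (forall x r, G (x, r) -> r <= nr x).

Lemma dominated_graph_scale G c x r :
  dominated_graph G -> G (x, r) -> G (c%:C *: x, c * r).
Proof.
move=> [Glin _] Gx; have := Glin (c - 1) _ _ _ _ Gx Gx.
by rewrite rmorphB/= rmorph1 scalerBl scale1r subrK mulrBl mul1r subrK.
Qed.

(** The value at [z] has to lie above all [r - nr (y - z)] and below all [nr (y' + z) - r'];
    domination on the old subspace separates the two families, and the supremum of the first is
    taken. *)
Lemma dominated_graph_extend G z : G !=set0 -> dominated_graph G ->
  exists a, dominated_graph
    [set p | exists c y r, G (y, r) /\ p = (y + c%:C *: z, r + c * a)].
Proof.
move=> [[y0 r0] G0] Gd; have [Glin Gle] := Gd.
pose S := [set s | exists y r, G (y, r) /\ s = r - nr (y - z)].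
have key y r y' r' : G (y, r) -> G (y', r') -> r - nr (y - z) <= nr (y' + z) - r'.
  move=> Gy Gy'; have := Gle _ _ (Glin 1 _ _ _ _ Gy Gy').
  rewrite rmorph1 scale1r mul1r.
  have : nr (y + y') <= nr (y - z) + nr (y' + z).
    by rewrite (_ : y + y' = (y - z) + (y' + z)) ?nrD// addrACA addNr addr0.
  lra.
have Ssup : has_sup S.
  split; first by exists (r0 - nr (y0 - z)), y0, r0.
  by exists (nr (y0 + z) - r0) => _ [y [r [Gy ->]]]; exact: key.
exists (sup S).
have up y r : G (y, r) -> r + sup S <= nr (y + z).
  move=> Gy; suff : sup S <= nr (y + z) - r by lra.
  by apply: ge_sup; [exact: Ssup.1|move=> _ [y' [r' [Gy' ->]]]; exact: key].
have dn y r : G (y, r) -> r - sup S <= nr (y - z).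
  move=> Gy; suff : r - nr (y - z) <= sup S by lra.
  by apply: ub_le_sup; [exact: Ssup.2|exists y, r].
split.
  move=> c _ _ _ _ [c1 [y1 [r1 [G1 [-> ->]]]]] [c2 [y2 [r2 [G2 [-> ->]]]]].
  exists (c * c1 + c2), (c%:C *: y1 + y2), (c * r1 + r2); split; first exact: Glin.
  congr (_, _); last by ring.
  by rewrite scalerDr scalerA rmorphD rmorphM/= scalerDl addrACA.
move=> _ _ [c [y [r [Gy [-> ->]]]]].
have [c0|c0|->] := ltgtP c 0.
- have := dn _ _ (dominated_graph_scale (- c)^-1 Gd Gy).
  have nc0 : 0 < - c by lra.
  have -> : y + c%:C *: z = (- c)%:C *: ((- c)^-1%:C *: y - z).
    rewrite scalerBr scalerA -rmorphM/= divff ?gt_eqF// rmorph1 scale1r.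
    by rewrite rmorphN/= scaleNr opprK.
  rewrite nrZ nrcR gtr0_norm// => h.
  have -> : r + c * sup S = - c * ((- c)^-1 * r - sup S) by field; lra.
  by rewrite ler_pM2l.
- have := up _ _ (dominated_graph_scale c^-1 Gd Gy).
  have -> : y + c%:C *: z = c%:C *: (c^-1%:C *: y + z).
    by rewrite scalerDr scalerA -rmorphM/= divff ?gt_eqF// rmorph1 scale1r.
  rewrite nrZ nrcR gtr0_norm// => h.
  have -> : r + c * sup S = c * (c^-1 * r + sup S) by field; lra.
  by rewrite ler_pM2l.
- by rewrite rmorph0 scale0r mul0r !addr0; exact: Gle.
Qed.

Lemma real_hahn_banach x0 : exists f : V -> R,
  [/\ forall c x y, f (c%:C *: x + y) = c * f x + f y,
      forall x, f x <= nr x & f x0 = nr x0].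
Proof.
pose G0 : set (V * R) := [set p | exists c, p = (c%:C *: x0, c * nr x0)].
have G0d : dominated_graph G0.
  split=> [c _ _ _ _ [c1 [-> ->]] [c2 [-> ->]]|_ _ [c [-> ->]]].
    exists (c * c1 + c2); congr (_, _); last by ring.
    by rewrite rmorphD rmorphM/= scalerDl scalerA.
  by rewrite nrZ nrcR ler_wpM2r ?nr_ge0 ?ler_norm.
(* [G0] is adjoined to every candidate: the empty chain is then harmless, and the maximal graph
   prescribes the value at [x0]. *)
have [|A [AP Amax]] := @Zorn_bigcup _ [set A | dominated_graph (A `|` G0)].
  move=> F FP Ftot /=; have [[B0 FB0]|F0] := pselect (F !=set0); last first.
    rewrite (_ : \bigcup_(X in F) X = set0) ?set0U//.
    by rewrite -subset0 => p [B FB]; exfalso; apply: F0; exists B.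
  have two p q : (\bigcup_(X in F) X `|` G0) p -> (\bigcup_(X in F) X `|` G0) q ->
      exists B, [/\ F B, (B `|` G0) p & (B `|` G0) q].
    move=> [[B1 F1 B1p]|G0p] [[B2 F2 B2q]|G0q].
    - have [B12|B21] := Ftot _ _ F1 F2.
        by exists B2; split=> //; left => //; exact: B12.
      by exists B1; split=> //; left => //; exact: B21.
    - by exists B1; split=> //; [left|right].
    - by exists B2; split=> //; [right|left].
    - by exists B0; split=> //; right.
  split=> [c x r y s Gx Gy|x r Gx].
    have [B [FB Bx By]] := two _ _ Gx Gy.
    have [Blin _] : dominated_graph (B `|` G0) := FP _ FB; move: (Blin c _ _ _ _ Bx By).
    by move=> [BB|]; [left; exists B|right].
  have [B [FB Bx _]] := two _ _ Gx Gx.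
  by have [_ Ble] : dominated_graph (B `|` G0) := FP _ FB; exact: Ble.
have {}AP : dominated_graph (A `|` G0) := AP; set G := A `|` G0 in AP.
have G00 : G (0, 0) by right; exists 0; rewrite rmorph0 scale0r mul0r.
have tot z : exists r, G (z, r).
  apply: contrapT => nz.
  have [|a Ga] := dominated_graph_extend z _ AP; first by exists (0, 0).
  set G' := [set p | _] in Ga.
  have GG' : G `<=` G'.
    by move=> [y r] Gy; exists 0, y, r; rewrite rmorph0 scale0r mul0r !addr0.
  apply: (Amax G'); last first.
    by rewrite /= setUidl//; apply: subset_trans GG' => p; right.
  split; first by apply: subset_trans GG' => p; left.
  move=> G'A; apply: nz; exists a; left; apply: G'A.
  by exists 1, 0, 0; rewrite rmorph1 scale1r mul1r !add0r.
have [Glin Gle] := AP.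
have /choice[f Gf] := tot.
have uniq x r : G (x, r) -> r = f x.
  move=> Gx; have Gd := Glin (-1) _ _ _ _ (Gf x) Gx.
  rewrite rmorphN1 scaleN1r addNr mulN1r in Gd.
  have := Gle _ _ (dominated_graph_scale 1 AP Gd).
  have := Gle _ _ (dominated_graph_scale (-1) AP Gd).
  by rewrite !scaler0 nr0; lra.
exists f; split=> [c x y|x|].
- by apply/esym/uniq/Glin.
- exact/Gle/Gf.
- by apply/esym/uniq; right; exists 1; rewrite rmorph1 scale1r mul1r.
Qed.

Lemma dual_separates x0 : x0 <> 0 -> exists g : dual V, g x0 <> 0.
Proof.
move=> x00; have [f [flin fle fx0]] := real_hahn_banach x0.
have f0 : f 0 = 0.
  by have := flin 1 0 0; rewrite rmorph1 scale1r mul1r addr0; lra.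
have fN x : f (- x) = - f x.
  by have := flin (-1) x 0; rewrite rmorphN1 scaleN1r mulN1r !addr0 f0 addr0.
have fD x y : f (x + y) = f x + f y.
  by have := flin 1 x y; rewrite rmorph1 scale1r mul1r.
have fZ c x : f (c%:C *: x) = c * f x.
  by have := flin c x 0; rewrite !addr0 f0 addr0.
have fabs x : `|f x| <= nr x.
  by rewrite ler_norml fle andbT lerNl -fN -(nrN x) fle.
(* The usual complexification of a real functional; the crude norm bound 2 is enough for
   continuity. *)
pose g (x : V) : R[i]^o := f x +i* - f ('i *: x).
have [||H HH] := @bounded_linear_bop _ _ _ g 2.
- move=> [a b] x y; rewrite /g.
  have ab : (a +i* b) = a%:C + 'i * b%:C by rewrite {1}[a +i* b]complexE.
  have E1 : f ((a +i* b) *: x) = a * f x + b * f ('i *: x).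
    by rewrite ab scalerDl fD fZ ['i * _]mulrC -scalerA fZ.
  have E2 : f ('i *: ((a +i* b) *: x)) = a * f ('i *: x) - b * f x.
    rewrite scalerA mulrC -scalerA ab scalerDl fD fZ ['i * _]mulrC -scalerA fZ.
    by rewrite scalerA -expr2 sqr_i scaleN1r fN mulrN.
  rewrite scalerDr !fD E1 E2; congr (_ +i* _); rewrite /=; ring.
- move=> x; rewrite nr_regular; apply: le_trans (nrc_ReIm _) _.
  rewrite /= normrN (_ : 2 * nr x = nr x + nr ('i *: x)) ?lerD//.
  by rewrite nrZ nrci mul1r; ring.
exists H; rewrite HH => /(congr1 (@complex.Re R))/= fx00.
by have := nr_gt0 x00; rewrite -fx0 fx00 ltxx.
Qed.

End HahnBanach.

(** * Growth of a sequence that jumps forwards or backwards *)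

Section OrbitGrowth.
Context {R : realType}.
Implicit Types (s : nat -> R) (C rho : R).

Lemma nat_argmax s m : exists2 j, (j <= m)%N & forall i, (i <= m)%N -> s i <= s j.
Proof.
elim: m => [|m [j jm Hj]]; first by exists 0 => // i; rewrite leqn0 => /eqP ->.
have [sj|sj] := leP (s m.+1) (s j).
  exists j => [|i]; first exact: leqW.
  by rewrite leq_eqVlt ltnS => /orP[/eqP ->//|]; exact: Hj.
exists m.+1 => // i; rewrite leq_eqVlt ltnS => /orP[/eqP ->//|im].
exact: le_trans (Hj _ im) (ltW sj).
Qed.

Lemma growth_iter s C : 0 <= C -> (forall i, s i.+1 <= C * s i) ->
  forall i n, s (i + n)%N <= C ^+ n * s i.
Proof.
move=> C0 sC i; elim=> [|n IH]; first by rewrite addn0 mul1r.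
rewrite addnS (le_trans (sC _))// exprS -mulrA ler_wpM2l//.
Qed.

(* Jumping repeatedly to a larger value within distance [N] leaves every window;
   the maximum over the window [0, 2n] therefore sits near one of its ends. *)
Lemma orbit_growth s C rho N r : 1 <= C -> 1 < rho -> (forall i, 0 <= s i) ->
  (forall i, s i.+1 <= C * s i) ->
  (forall i, (N <= i)%N -> exists2 l, (0 < l <= N)%N &
     rho * s i <= s (i + l)%N \/ rho * s i <= s (i - l)%N) ->
  let n := (r.+1 * N)%N in
  rho ^+ r * s n <= C ^+ N * s (n + n)%N \/ rho ^+ r * s n <= C ^+ N * s 0.
Proof.
move=> C1 rho1 s0 sC jump n.
have C0 : 0 <= C by lra.
have CN m : (m <= N)%N -> C ^+ m <= C ^+ N by exact: ler_weXn2l.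
have CN0 i : 0 <= C ^+ N * s i by rewrite mulr_ge0 ?exprn_ge0.
have climb q : (q <= r)%N -> exists2 j, (n <= j + q * N)%N && (j <= n + q * N)%N &
    rho ^+ q * s n <= s j.
  elim: q => [|q IH] qr; first by exists n; rewrite ?mul1r// mul0n !addn0 leqnn.
  have [j /andP[j1 j2] Hj] := IH (ltnW qr).
  (* [n = r.+1 * N] leaves room for [r] jumps of length at most [N] from [n], each starting at an
     index not below [N], as [jump] demands. *)
  have [|l /andP[l0 lN] Hl] := jump j.
    move: j1; rewrite /n mulSn => j1; have : (q.+1 * N <= r * N)%N by rewrite leq_mul2r qr orbT.
    rewrite mulSn; lia.
  case: Hl => Hl.
    exists (j + l)%N; first by rewrite mulSn; apply/andP; split; lia.
    by apply: le_trans Hl; rewrite exprS -mulrA ler_wpM2l//; lra.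
  exists (j - l)%N; first by rewrite mulSn; apply/andP; split; lia.
  by apply: le_trans Hl; rewrite exprS -mulrA ler_wpM2l//; lra.
have [sn0|sn0] := eqVneq (s n) 0; first by left; rewrite sn0 mulr0.
have snp : 0 < s n by rewrite lt0r sn0 s0.
have [j jn Hj] := nat_argmax s (n + n)%N.
have sj : rho ^+ r * s n <= s j.
  have [i /andP[_ i2] Hi] := climb r (leqnn r).
  apply: (le_trans Hi); apply: Hj; apply: (leq_trans i2).
  by rewrite leq_add2l leq_mul2r leqnSn orbT.
have sjp : 0 < s j by apply: lt_le_trans sj; rewrite mulr_gt0// exprn_gt0//; lra.
have rj : s j < rho * s j by rewrite ltr_pMl.
have [jN|jN] := leqP N j; last first.
  right; apply: (le_trans sj); have := growth_iter C0 sC 0 j.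
  by rewrite add0n => /le_trans; apply; rewrite ler_wpM2r// CN// ltnW.
left; apply: (le_trans sj).
have [l /andP[l0 lN] [Hl|Hl]] := jump j jN; last first.
  by have := Hj (j - l)%N (leq_trans (leq_subr _ _) jn); lra.
have [jl|jl] := leqP (j + l)%N (n + n)%N; first by have := Hj _ jl; lra.
have := growth_iter C0 sC (n + n)%N (j + l - (n + n))%N.
rewrite subnKC; last exact: ltnW.
move=> H; apply: le_trans (_ : s (j + l)%N <= _); first by lra.
apply: (le_trans H); rewrite ler_wpM2r// CN//; lia.
Qed.

End OrbitGrowth.

(** * Clopen sets in a compact extremally disconnected space *)

Section Clopen.
Context {K : topologicalType}.
Hypothesis K_compact : compact [set: K].
Hypothesis K_hausdorff : hausdorff_space K.
Hypothesis K_extremal : extremally_disconnected K.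

Lemma clopen_nbhs (k : K) (O : set K) : nbhs k O ->
  exists G, [/\ clopen G, G k & G `<=` O].
Proof.
move=> kO; have [B kB BO] := compact_regular K_hausdorff K_compact filterT kO.
exists (closure B^°).
have Gc : clopen (closure B^°).
  by split; [apply: K_extremal; exact: open_interior|exact: closed_closure].
split=> //; first by apply: subset_closure; exact: kB.
exact: subset_trans (closure_subset (@interior_subset _ B)) BO.
Qed.

(** Normality gives an open set containing the complement of [F] with closure inside [E]; extremal
    disconnectedness makes that closure clopen. *)
Lemma clopen_split (E F : set K) : open E -> open F -> E `|` F = setT ->
  exists G, [/\ clopen G, G `<=` E & ~` G `<=` F].
Proof.
move=> oE oF EF.
have cF : closed (~` F) by exact: open_closedC.
have FE : set_nbhs (~` F) E.
  apply/set_nbhsP; exists E; split=> // k nFk.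
  by have : (E `|` F) k by [rewrite EF]; case.
have [B /set_nbhsP[W [oW FW WB]] BE] := compact_normal K_hausdorff K_compact cF FE.
exists (closure W); split; first by split; [exact: K_extremal|exact: closed_closure].
  by apply: subset_trans BE; exact: closure_subset.
rewrite -[X in _ `<=` X]setCK; apply: subsetC.
by apply: subset_trans FW _; exact: subset_closure.
Qed.

(** A non-periodic point differs from each of its iterates, so [L] Hausdorff separations intersect
    to a neighbourhood that is disjoint from its first [L] images. *)
Lemma clopen_disjoint_iter (phi : continuousType K K) (b : K) (O : set K) L :
  periodic_points phi = set0 -> nbhs b O ->
  exists G, [/\ clopen G, G b, G `<=` O &
    forall l x, (0 < l <= L)%N -> G x -> ~ G (iter l phi x)].
Proof.
move=> nper bO.
have iter_cts l : continuous (iter l phi).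
  elim: l => [|l IH] x; first exact: cvg_id.
  by apply: (@continuous_comp _ _ _ (iter l phi) phi); [exact: IH|exact: cts_fun].
have sep l : exists O', nbhs b O' /\ ((0 < l)%N -> forall x, O' x -> ~ O' (iter l phi x)).
  have [->|l0] := posnP l; first by exists setT; split=> //; exact: filterT.
  have bl : b != iter l phi b.
    apply/eqP => bl; have : periodic_points phi b by exists l.
    by rewrite nper.
  have := K_hausdorff; rewrite open_hausdorff => /(_ _ _ bl)[[A B]]/=.
  rewrite !inE => -[bA lB] [oA oB AB].
  exists (A `&` iter l phi @^-1` B); split.
    apply: filterI; first exact: open_nbhs_nbhs.
    by apply: iter_cts; exact: open_nbhs_nbhs.
  move=> _ x [Ax Bx] [Al _].
  by have : (A `&` B) (iter l phi x) by []; rewrite AB.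
have [O' HO'] := choice sep.
have [|G [Gc Gb GO]] := @clopen_nbhs b (O `&` [set x | forall l, (l < L.+1)%N -> O' l x]).
  apply: filterI => //; elim: {+}(L.+1) => [|m IH]; first by apply: filterS filterT.
  have := (HO' m).1 => Hm; near=> x => l; rewrite ltnS leq_eqVlt => /orP[/eqP ->|].
    by near: x.
  move: l; near: x; exact: IH.
exists G; split=> //; first by move=> x /GO[].
move=> l x /andP[l0 lL] /GO[_ /(_ _ lL)Ox] /GO[_ /(_ _ lL)].
by have := (HO' l).2 l0 _ Ox.
Unshelve. all: by end_near. Qed.

(** Without isolated points [G] has a second point: a clopen piece around the first is split off,
    and the second keeps the rest nonempty for the induction. *)
Lemma clopen_pieces (G : set K) d : isolated [set: K] = set0 ->
  open G -> G !=set0 -> exists H : nat -> set K,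
    (forall i, (i < d)%N -> [/\ clopen (H i), H i !=set0 & H i `<=` G]) /\
    (forall i j x, (i < d)%N -> (j < d)%N -> H i x -> H j x -> i = j).
Proof.
move=> niso; elim: d G => [|d IH] G oG [a Ga]; first by exists (fun=> G).
have [b [Gb ab]] : exists b, G b /\ a != b.
  apply: contrapT => nb; have : isolated [set: K] a; last by rewrite niso.
  split; first by rewrite inE.
  exists G; first exact: open_nbhs_nbhs.
  rewrite setIT; apply/seteqP; split=> [x Gx|x ->//].
  by apply: contrapT => xa; apply: nb; exists x; split=> //; apply/eqP => ax; apply: xa.
have := K_hausdorff; rewrite open_hausdorff => /(_ _ _ ab)[[A B]]/=.
rewrite !inE => -[aA bB] [oA oB AB].
have [|G1 [G1c G1a G1G]] := @clopen_nbhs a (G `&` A).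
  by apply: filterI; exact: open_nbhs_nbhs.
have [||H [H1 H2]] := IH (G `&` ~` G1).
- by apply: openI => //; apply: closed_openC; exact: G1c.2.
- exists b; split=> // /G1G[_ Ab].
  by have : (A `&` B) b by []; rewrite AB.
exists (fun i => if i is i'.+1 then H i' else G1); split.
  move=> [_|i id]; first by split=> //; [exists a|move=> x /G1G[]].
  by have [Hc H0 HG] := H1 _ id; split=> // x /HG[].
move=> [|i] [|j] x id jd//.
- by move=> G1x Hx; have [_ _ /(_ _ Hx)[_]] := H1 j jd.
- by move=> Hx G1x; have [_ _ /(_ _ Hx)[_]] := H1 i id.
- by move=> Hi Hj; congr S; exact: H2 Hi Hj.
Qed.

End Clopen.

(** * Continuous functions and the cocycle of a weight *)

Section CtsFunctions.
Context {R : realType} {K : topologicalType}.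
Local Notation CK := (continuousType K R[i]^o).
Implicit Types (f w : CK) (G : set K).

Lemma cts_ext (f g : CK) : f =1 g -> f = g.
Proof. by move=> fg; apply/val_inj/funext. Qed.

Lemma cts_nbhs f (k : K) (e : R) : 0 < e -> \forall x \near k, nrc (f x - f k) <= e.
Proof.
move=> e0; have /cvgrPdist_le/(_ e%:C%C)  := @cts_fun _ _ f k.
rewrite ltcR => /(_ e0); apply: filterS => x.
by rewrite distrC nrc_le.
Qed.

Lemma open_nrc_lt f (c : R) : open [set k | nrc (f k) < c].
Proof.
rewrite openE => k /= fk.
have e0 : 0 < (c - nrc (f k)) / 2 by rewrite divr_gt0 ?subr_gt0.
apply: filterS (cts_nbhs f k e0) => x /= H.
have := nrcD (f x - f k) (f k); rewrite subrK; lra.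
Qed.

Lemma open_nrc_gt f (c : R) : open [set k | c < nrc (f k)].
Proof.
rewrite openE => k /= fk.
have e0 : 0 < (nrc (f k) - c) / 2 by rewrite divr_gt0 ?subr_gt0.
apply: filterS (cts_nbhs f k e0) => x /= H.
have := nrcD (f k - f x) (f x); rewrite subrK -[nrc (_ - f x)]nrcN opprB; lra.
Qed.

Lemma cts_of_nbhs (F : K -> R[i]^o) :
  (forall k, exists2 g : K -> R[i]^o, {for k, continuous g} & \forall x \near k, F x = g x) ->
  exists f : CK, f =1 F.
Proof.
move=> Fg; suff FP : F \in @cts_pred R[i] K by exists (cts_Sub FP).
rewrite inE => k; have [g gk Fgk] := Fg k.
rewrite /continuous_at (nbhs_singleton Fgk); apply: cvg_trans gk.
by apply: near_eq_cvg; apply: filterS Fgk => x ->.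
Qed.

Lemma cts_bounded f : compact [set: K] -> exists2 C : R, 1 <= C & forall k, nrc (f k) <= C.
Proof.
move=> /compact_near_coveringP Kc.
have : \forall n \near \oo, [set: K] `<=` [set k | nrc (f k) < n%:R].
  apply: Kc => k _.
  exists ([set x | nrc (f x - f k) <= 1], [set n | 1 + nrc (f k) < n%:R]).
    split=> /=; first exact: cts_nbhs.
    exact: nbhs_infty_gtr.
  move=> [x n] [/= xk kn]; apply: le_lt_trans kn.
  by rewrite -[f x](subrK (f k)); apply: le_trans (nrcD _ _) _; rewrite lerD2r.
move=> [n _ /(_ n (leqnn n)) Hn].
exists (n%:R + 1); first by rewrite lerDr.
by move=> k; have /= := Hn k I; lra.
Qed.

(** The function [1/f] on [G], extended by zero; it stays continuous because [G] is clopen. Through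
    it, division by a cocycle becomes a bounded operator. *)
Lemma clopen_inverse f G (a : R) : clopen G -> 0 < a ->
  (forall k, G k -> a <= nrc (f k)) ->
  exists h : CK, forall k, h k * f k = (k \in G)%:R /\ nrc (h k) <= a^-1.
Proof.
move=> [oG cG] a0 fa.
have [k|h Hh] := @cts_of_nbhs (fun k => if k \in G then (f k)^-1 else 0).
  have [kG|kG] := boolP (k \in G).
    exists (fun k => (f k)^-1).
      rewrite /continuous_at; apply: cvgV; last exact: cts_fun.
      rewrite -nrc_eq0 gt_eqF//; apply: lt_le_trans a0 _; apply: fa; exact: set_mem.
    have : \forall x \near k, G x by apply: open_nbhs_nbhs; split=> //; exact: set_mem.
    by apply: filterS => x Gx; rewrite mem_set.
  exists (fun=> 0); first exact: cvg_cst.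
  have : \forall x \near k, (~` G) x.
    apply: open_nbhs_nbhs; split; first exact: closed_openC.
    by move=> Gk; rewrite mem_set in kG.
  by apply: filterS => x Gx; rewrite memNset.
exists h => k; rewrite Hh; case: ifPn => kG; last by rewrite mul0r nrc0 invr_ge0 ltW.
have fk : a <= nrc (f k) by apply: fa; exact: set_mem.
have fk0 : 0 < nrc (f k) by exact: lt_le_trans fk.
by rewrite mulVf -?nrc_eq0 ?gt_eqF// nrcV lef_pV2.
Qed.

Lemma clopen_indic G : clopen G -> exists f : CK, forall k, f k = (k \in G)%:R.
Proof.
move=> cG; have [|h Hh] := @clopen_inverse 1 G 1 cG ltr01.
  by move=> k _; rewrite [X in nrc X](_ : _ = 1)// nrc1.
by exists h => k; have [<- _] := Hh k; rewrite [X in _ * X](_ : _ = 1)// mulr1.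
Qed.

Variable phi : continuousType K K.

Fixpoint cocycle w n : CK :=
  if n is n'.+1 then cts_comp (cocycle w n') phi * w else 1.

Definition comp_iter n f : CK := iter n (fun g => cts_comp g phi) f.

Lemma comp_iterE n f k : comp_iter n f k = f (iter n phi k).
Proof. by elim: n k => // n IH k; rewrite iterSr -IH. Qed.

Lemma cocycle1 w : cocycle w 1 = w.
Proof. by apply: cts_ext => k; rewrite /= [LHS](_ : _ = 1 * w k)// mul1r. Qed.

Lemma cocycleD w m n k : cocycle w (m + n) k = cocycle w m k * cocycle w n (iter m phi k).
Proof.
elim: m k => [|m IH] k; first by rewrite [RHS](_ : _ = 1 * cocycle w n k)// mul1r.
rewrite addSn [LHS](_ : _ = cocycle w (m + n) (phi k) * w k)// IH iterSr.
by rewrite [cocycle w m.+1 k](_ : _ = cocycle w m (phi k) * w k)// mulrAC.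
Qed.

Lemma cocycleSr w n k : cocycle w n.+1 k = cocycle w n k * w (iter n phi k).
Proof. by rewrite -addn1 cocycleD cocycle1. Qed.

Lemma cocycleZ w (a : R[i]) n k : cocycle (a *: w) n k = a ^+ n * cocycle w n k.
Proof.
elim: n k => [|n IH] k; first by rewrite expr0 mul1r.
by rewrite !cocycleSr IH [(a *: w) _](_ : _ = a * w (iter n phi k))// exprSr mulrACA.
Qed.

Lemma cocycle_comp w n k : cocycle (cts_comp w phi) n k = cocycle w n (phi k).
Proof. by elim: n k => // n IH k; rewrite !cocycleSr IH -iterSr. Qed.

End CtsFunctions.

(** * The dichotomy when no peak orbit exists *)

Section Dichotomy.
Context {R : realType} {K : topologicalType}.
Local Notation CK := (continuousType K R[i]^o).
Variables (phi psi : continuousType K K) (w : CK).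
Hypotheses (phiK : cancel phi psi) (psiK : cancel psi phi).

(* [k] carries an orbit along which the products of the weight are largest at
   the base point; this governs both spectra of the theorem. *)
Definition peak_orbit (l : R[i]) := exists k, forall n,
  nrc (cocycle phi w n k) <= nrc l ^+ n /\
  nrc l ^+ n <= nrc (cocycle phi w n (iter n psi k)).

Definition subexponential (a : nat -> R) := forall rho, 1 < rho ->
  exists2 C, 0 < C & forall n, a n <= C * rho ^+ n.

(** A substitute for the [m]-th root: [(1 + x)^m (1 - x)^m <= 1], and Bernoulli bounds [(1 - x)^m]
    below by [1 - m x > c^-1]. *)
Lemma root_gt1 (c : R) m : 1 < c -> exists2 rho, 1 < rho & rho ^+ m < c.
Proof.
move=> c1; have c0 : 0 < c by lra.
have m1 : 0 < m.+1%:R :> R by rewrite ltr0n.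
pose x := (1 - c^-1) / m.+1%:R.
have ci : c^-1 < 1 by rewrite invf_lt1.
have ci0 : 0 < c^-1 by rewrite invr_gt0.
have x0 : 0 < x by rewrite divr_gt0// subr_gt0.
have xm : x * m.+1%:R = 1 - c^-1 by rewrite divfK// gt_eqF.
have mx : m%:R * x < 1 - c^-1 by rewrite -xm -natr1; lra.
have mx0 : 0 <= m%:R * x by rewrite mulr_ge0 ?ler0n ?ltW.
have x1 : x <= 1.
  have : x * m%:R = m%:R * x by rewrite mulrC.
  by move: xm; rewrite -natr1; lra.
exists (1 + x); first lra.
have b : c^-1 < (1 - x) ^+ m.
  by apply: lt_le_trans (bernoulli m _); lra.
have p0 : 0 < (1 + x) ^+ m by rewrite exprn_gt0//; lra.
have : (1 + x) ^+ m * (1 - x) ^+ m <= 1.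
  rewrite -exprMn exprn_ile1//; last by have := sqr_ge0 x; rewrite expr2; lra.
  by rewrite mulr_ge0//; lra.
have : (1 + x) ^+ m * c^-1 < (1 + x) ^+ m * (1 - x) ^+ m by rewrite ltr_pM2l.
move=> h1 h2; have := lt_le_trans h1 h2.
by rewrite ltr_pdivrMr// mul1r.
Qed.

Lemma near_natSinv (d : R) : 0 < d -> \forall N \near \oo, N.+1%:R^-1 < d.
Proof.
move=> d0; near=> N; rewrite -[d]invrK ltf_pV2 ?posrE ?invr_gt0 ?ltr0n//.
apply: (@lt_trans _ _ N%:R); last by rewrite ltr_nat.
by near: N; exact: nbhs_infty_gtr.
Unshelve. all: by end_near. Qed.

Lemma iter_cancel n : cancel (iter n phi) (iter n psi).
Proof. by elim: n => // n IH k; rewrite iterSr /= phiK IH. Qed.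

Lemma iter_cancel' n : cancel (iter n psi) (iter n phi).
Proof. by elim: n => // n IH k; rewrite iterSr /= psiK IH. Qed.

(** At each point the peak condition fails by a strict inequality for some [n], hence also nearby;
    compactness makes this uniform. A single index [N] bounds the length and, through [1 + 1/(N+1)],
    the factor. *)
Lemma uniform_jump : compact [set: K] -> ~ peak_orbit 1 ->
  exists N, exists2 c : R, 1 < c & forall k, exists2 n, (0 < n <= N)%N &
    c < nrc (cocycle phi w n k) \/ nrc (cocycle phi w n (iter n psi k)) * c < 1.
Proof.
move=> /compact_near_coveringP Kc npeak.
pose P N k := exists2 n, (0 < n <= N)%N & 1 + N.+1%:R^-1 < nrc (cocycle phi w n k) \/
  nrc (cocycle phi w n (iter n psi k)) * (1 + N.+1%:R^-1) < 1.
suff : \forall N \near \oo, [set: K] `<=` P N.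
  move=> [N _ /(_ N (leqnn N)) HN]; exists N, (1 + N.+1%:R^-1); last by move=> k; exact: HN.
  by rewrite ltrDl invr_gt0 ltr0n.
apply: Kc => k _.
have [n Hn] : exists n, 1 < nrc (cocycle phi w n k) \/
    nrc (cocycle phi w n (iter n psi k)) < 1.
  apply: contrapT => H; apply: npeak; exists k => n; rewrite nrc1 expr1n.
  split; rewrite leNgt; apply/negP => Hk; apply: H; exists n; [by left|by right].
have n0 : (0 < n)%N.
  case: n Hn => // -[]; rewrite [cocycle _ _ _ _](_ : _ = 1)// nrc1 ltxx//.
case: Hn => Hn.
  pose d := (nrc (cocycle phi w n k) - 1) / 2.
  have d0 : 0 < d by rewrite divr_gt0// subr_gt0.
  have dk : 1 + d < nrc (cocycle phi w n k) by rewrite /d; lra.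
  exists ([set x | 1 + d < nrc (cocycle phi w n x)],
          [set N | (n <= N)%N /\ N.+1%:R^-1 < d]).
    split=> /=; first by apply: open_nbhs_nbhs; split; [exact: open_nrc_gt|exact: dk].
    near=> N; split; near: N; [exact: nbhs_infty_ge|exact: near_natSinv].
  by move=> [x N] [/= xd [nN Nd]]; exists n; [rewrite n0|left; apply: lt_trans xd; rewrite ltrD2l].
pose u := (1 + nrc (cocycle phi w n (iter n psi k))) / 2.
have u0 : 0 <= u by rewrite divr_ge0// addr_ge0 ?nrc_ge0.
have d0 : 0 < 1 - u by rewrite /u; lra.
have uk : nrc (cocycle phi w n (iter n psi k)) < u by rewrite /u; lra.
exists ([set x | nrc (comp_iter psi n (cocycle phi w n) x) < u],
        [set N | (n <= N)%N /\ N.+1%:R^-1 < 1 - u]).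
  split=> /=.
    by apply: open_nbhs_nbhs; split; [exact: open_nrc_lt|rewrite /= comp_iterE].
  near=> N; split; near: N; [exact: nbhs_infty_ge|exact: near_natSinv].
move=> [x N] [/= + [nN Nd]]; rewrite comp_iterE => xu.
exists n; [by rewrite n0|right].
have N0 : 0 <= N.+1%:R^-1 :> R by rewrite invr_ge0 ler0n.
set v := nrc _ in xu *; set t := N.+1%:R^-1 in Nd N0 *.
have : v * t <= 1 * t by rewrite ler_wpM2r//; lra.
lra.
Unshelve. all: by end_near. Qed.

Lemma cocycle_dichotomy (a : nat -> R) : compact [set: K] ->
  subexponential a -> ~ peak_orbit 1 ->
  exists n, forall k, a n < nrc (cocycle phi w n k) \/
    nrc (cocycle phi w n (iter n psi k)) * a n < 1.
Proof.
move=> Kc asub npeak.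
have [N [c c1 jump]] := uniform_jump Kc npeak.
have [C C1 wC] := cts_bounded w Kc.
have [rho rho1 rhoN] := root_gt1 N c1.
have rN0 : 0 < rho ^+ N by rewrite exprn_gt0//; lra.
have q1 : 1 < c / rho ^+ N by rewrite ltr_pdivlMr// mul1r.
have CN0 : 0 < C ^+ N by rewrite exprn_gt0//; lra.
have c0 : 0 < c by lra.
have [C2 C20 aC] := asub _ rho1.
(* Because [rho ^ N < c], the gain [c ^ r] of [r] jumps outgrows [C ^ N * a n] for
   [n = r.+1 * N]. *)
have [r /(_ r (leqnn r)) Hr] := pow_large (C ^+ N * C2 * rho ^+ N) q1.
pose n := (r.+1 * N)%N; exists n => k.
have aN : C ^+ N * a n < c ^+ r.
  apply: le_lt_trans (_ : C ^+ N * C2 * rho ^+ n < _).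
    by rewrite -mulrA ler_pM2l.
  rewrite /n mulSn exprD mulrA [(r * N)%N]mulnC exprM.
  by move: Hr; rewrite expr_div_n ltr_pdivlMr// exprn_gt0.
(* Starting the orbit at [b] puts [k] in the middle of the window: [s n] is the product before [k],
   and [s (n + n) / s n] the product after it. *)
pose b := iter n psi k; pose s i := nrc (cocycle phi w i b).
have s0 i : 0 <= s i by exact: nrc_ge0.
have sC i : s i.+1 <= C * s i by rewrite /s cocycleSr nrcM mulrC ler_wpM2r ?nrc_ge0.
have sjump i : (N <= i)%N -> exists2 l, (0 < l <= N)%N &
    c * s i <= s (i + l)%N \/ c * s i <= s (i - l)%N.
  move=> Ni; have [l lN Hl] := jump (iter i phi b); exists l => //.
  case: Hl => Hl; [left|right].
    by rewrite /s cocycleD nrcM mulrC ler_wpM2l ?nrc_ge0// ltW.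
  have li : (l <= i)%N by case/andP: lN => _ lN; exact: leq_trans Ni.
  rewrite -{1}(subnK li) /s cocycleD nrcM mulrCA.
  rewrite -{1}(subnKC li) iterD iter_cancel in Hl.
  by rewrite ler_piMr ?nrc_ge0// mulrC ltW.
have sn : s (n + n)%N = s n * nrc (cocycle phi w n k).
  by rewrite /s cocycleD nrcM /b iter_cancel'.
have sE : nrc (cocycle phi w n (iter n psi k)) = s n by [].
have s00 : s 0 = 1 by rewrite /s [cocycle _ _ _ _](_ : _ = 1)// nrc1.
rewrite sE; have [sn0|sn0] := eqVneq (s n) 0; first by right; rewrite sn0 mul0r.
have snp : 0 < s n by rewrite lt0r sn0 s0.
have aNs : C ^+ N * a n * s n < c ^+ r * s n by rewrite ltr_pM2r.
have [|] := orbit_growth r C1 c1 s0 sC sjump; rewrite -/n => H; [left|right].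
  move: H; rewrite sn => /(lt_le_trans aNs).
  by rewrite mulrAC mulrA ltr_pM2l// mulr_gt0.
move: H; rewrite s00 mulr1 => /(lt_le_trans aNs).
by rewrite -mulrA gtr_pMr// mulrC.
Qed.

End Dichotomy.

(** * Weighted operators: boundedness below without a peak *)

Section WeightedOperator.
Context {R : realType} {K : topologicalType} {Y : normedModType R[i]}.
Local Notation CK := (continuousType K R[i]^o).
Variables (phi psi : continuousType K K) (M : CK -> 'L(Y)) (V V1 : 'L(Y)).

(* The properties shared by the module X with U^-1 and its dual with U'. *)
Record weighted_setting : Prop := {
  ws_compact : compact [set: K] ;
  ws_hausdorff : hausdorff_space K ;
  ws_extremal : extremally_disconnected K ;
  ws_phiK : cancel phi psi ;
  ws_psiK : cancel psi phi ;
  ws_M1 : M 1 = 1 ;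
  ws_MM : forall f g : CK, M (f * g) = M f * M g ;
  ws_MD : forall (a : R[i]) (f g : CK), M (a *: f + g) = a *: M f + M g ;
  ws_M_le : forall (f : CK) (b : R) y, 0 <= b -> (forall k, nrc (f k) <= b) -> nr (M f y) <= b * nr y ;
  ws_M_inj : forall f : CK, M f = 0 -> f = 0 ;
  ws_VV1 : V * V1 = 1 ;
  ws_V1V : V1 * V = 1 ;
  ws_MV : forall f : CK, M f * V = V * M (cts_comp f phi) ;
  ws_V_growth : subexponential (fun n => nr (V ^+ n)) ;
  ws_V1_growth : subexponential (fun n => nr (V1 ^+ n))
}.

Hypothesis ws : weighted_setting.
Implicit Types f g w : CK.

Lemma ws_M0 : M 0 = 0.
Proof. by have := ws_MD ws (-1) 0 0; rewrite scaler0 addr0 scaleN1r addNr. Qed.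

Lemma ws_MDD f g : M (f + g) = M f + M g.
Proof. by have := ws_MD ws 1 f g; rewrite !scale1r. Qed.

Lemma ws_MZ a f : M (a *: f) = a *: M f.
Proof. by have := ws_MD ws a f 0; rewrite ws_M0 !addr0. Qed.

Lemma ws_M_comm f g : M f * M g = M g * M f.
Proof. by rewrite -!(ws_MM ws) mulrC. Qed.

Lemma ws_MVn f n : M f * V ^+ n = V ^+ n * M (comp_iter phi n f).
Proof.
elim: n f => [|n IH] f; first by rewrite !expr0 mul1r mulr1.
by rewrite exprS mulrA (ws_MV ws) -mulrA IH mulrA /comp_iter iterSr.
Qed.

Lemma ws_Vn_cancel n : V1 ^+ n * V ^+ n = 1.
Proof.
elim: n => [|n IH]; first by rewrite !expr0 mulr1.
by rewrite exprSr exprS mulrA -(mulrA _ V1) (ws_V1V ws) mulr1.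
Qed.

Lemma ws_power w n : (V * M w) ^+ n = V ^+ n * M (cocycle phi w n).
Proof.
elim: n => [|n IH]; first by rewrite !expr0 mul1r (ws_M1 ws).
by rewrite exprSr IH -mulrA (mulrA (M _)) (ws_MV ws) -mulrA -(ws_MM ws) mulrA -exprSr.
Qed.

Lemma power_dist (S : 'L(Y)) n (y : Y) :
  nr (y - (S ^+ n) y) <= (\sum_(i < n) nr (S ^+ i)) * nr (y - S y).
Proof.
elim: n => [|n IH]; first by rewrite big_ord0 mul0r [X in y - X](_ : _ = y)// subrr nr0.
rewrite big_ord_recr/= mulrDl.
have -> : y - (S ^+ n.+1) y = (y - (S ^+ n) y) + (S ^+ n) (y - S y).
  by rewrite linearB/= exprSr addrA subrK.
by apply: nrD_le => //; exact: bop_nr.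
Qed.

Lemma unit_bounded_below w : ~ peak_orbit phi psi w 1 ->
  exists C : R, forall y, nr y <= C * nr (y - (V * M w) y).
Proof.
(* The factor 4 leaves at most a quarter of [nr y] on each of the two clopen pieces, so half of
   [nr y] is absorbed at the end. *)
move=> npeak; pose a n := 4 * (1 + nr (V ^+ n) + nr (V1 ^+ n)).
have asub : subexponential a.
  move=> rho rho1; have [C C0 HC] := ws_V_growth ws rho1.
  have [C' C'0 HC'] := ws_V1_growth ws rho1.
  exists (4 * (1 + C + C')) => [|n]; first by rewrite mulr_gt0//; lra.
  rewrite /a -mulrA ler_pM2l// !mulrDl !lerD// mul1r exprn_ege1// ltW//.
have [n Hn] := cocycle_dichotomy (ws_phiK ws) (ws_psiK ws) (ws_compact ws) asub npeak.
have nV0 := nr_ge0 (V ^+ n); have nV10 := nr_ge0 (V1 ^+ n).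
have a0 : 0 < a n by rewrite /a; lra.
have ai0 : 0 <= (a n)^-1 by rewrite invr_ge0 ltW.
have aV : (a n)^-1 * nr (V ^+ n) <= 4^-1.
  by rewrite mulrC ler_pdivrMr// /a; lra.
have aV1 : (a n)^-1 * nr (V1 ^+ n) <= 4^-1.
  by rewrite mulrC ler_pdivrMr// /a; lra.
set wn := cocycle phi w n in Hn.
pose wn' := comp_iter psi n wn.
have cover : [set k | a n < nrc (wn k)] `|` [set k | nrc (wn' k) < (a n)^-1] = setT.
  apply/seteqP; split=> // k _; case: (Hn k) => Hk; [by left|right].
  by rewrite /= /wn' comp_iterE -[(a n)^-1]mul1r ltr_pdivlMr.
have [E [Ec EE EF]] := clopen_split (ws_compact ws) (ws_hausdorff ws) (ws_extremal ws)
  (open_nrc_gt wn (a n)) (open_nrc_lt wn' (a n)^-1) cover.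
have [h Hh] := clopen_inverse (f := wn) Ec a0 (fun k Ek => ltW (EE k Ek)).
have [eE HeE] := clopen_indic (R := R) Ec.
pose S := V * M w; pose c := \sum_(i < n) nr (S ^+ i).
have Sn : S ^+ n = V ^+ n * M wn by exact: ws_power.
exists (3 * c) => y; set D := nr (y - S y).
have D0 : 0 <= D by exact: nr_ge0.
have c0 : 0 <= c by rewrite sumr_ge0// => i _; exact: nr_ge0.
have yD : nr (y - (S ^+ n) y) <= c * D by exact: power_dist.
have SyD : nr ((S ^+ n) y) <= nr y + c * D.
  rewrite -[(S ^+ n) y](subrK y) addrC; apply: nrD_le => //.
  by rewrite nrB.
have eE_le k : nrc (eE k) <= 1.
  by rewrite HeE; case: (k \in E); rewrite ?nrc0 ?nrc1.
have hE : nr (M eE y) <= (a n)^-1 * (nr (V1 ^+ n) * (nr y + c * D)).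
  (* On [E] the part of [y] is recovered from [S ^+ n y]: cut to the image of [E], apply the inverse
     of [V ^+ n], and divide by the large [wn]. *)
  have -> : M eE y = M h ((V1 ^+ n) (M (comp_iter psi n eE) ((S ^+ n) y))).
    have -> : (V1 ^+ n) (M (comp_iter psi n eE) ((S ^+ n) y)) = M (wn * eE) y.
      rewrite -!bopMx Sn !mulrA -(mulrA (V1 ^+ n)) ws_MVn mulrA ws_Vn_cancel mul1r.
      rewrite -(ws_MM ws) mulrC; congr (M (_ * _) y).
      by apply: cts_ext => k; rewrite !comp_iterE iter_cancel//; exact: ws_phiK.
    rewrite -bopMx -(ws_MM ws); congr (M _ y); apply: cts_ext => k.
    rewrite [RHS](_ : _ = h k * (wn k * eE k))// mulrA (Hh k).1 HeE.
    by case: (k \in E); rewrite ?mulr1 ?mulr0.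
  apply: le_trans (ws_M_le ws _ ai0 (fun k => (Hh k).2)) _.
  rewrite ler_pM2l ?invr_gt0//; apply: le_trans (bop_nr _ _) _.
  rewrite ler_wpM2l//; apply: le_trans (ws_M_le ws _ ler01 _) _.
    by move=> k; rewrite comp_iterE.
  by rewrite mul1r.
have hF : nr (M (1 - eE) y) <= (a n)^-1 * nr (V ^+ n) * nr y + c * D.
  have eF_le k : nrc ((1 - eE) k) <= 1.
    rewrite [X in nrc X](_ : _ = 1 - eE k)// HeE.
    by case: (k \in E); rewrite ?subrr ?subr0 ?nrc0 ?nrc1.
  have -> : M (1 - eE) y = M (1 - eE) ((S ^+ n) y) + M (1 - eE) (y - (S ^+ n) y).
    by rewrite -linearD [_ + (y - _)]addrC subrK.
  apply: nrD_le; last first.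
    by apply: le_trans (ws_M_le ws _ ler01 eF_le) _; rewrite mul1r.
  (* Off [E] the map [S ^+ n] contracts: pulled back through [V ^+ n], the cut-off lives where [wn]
     is below [(a n)^-1]. *)
  rewrite -bopMx Sn mulrA ws_MVn -mulrA -(ws_MM ws) bopMx.
  apply: le_trans (bop_nr _ _) _; rewrite mulrAC mulrC -mulrA.
  rewrite [X in _ <= X](_ : _ = nr (V ^+ n) * ((a n)^-1 * nr y)); last by ring.
  rewrite mulrC ler_wpM2l//; apply: (ws_M_le ws _ ai0).
  move=> k; set f := comp_iter _ _ _.
  rewrite [X in nrc X](_ : _ = f k * wn k)// /f comp_iterE.
  set x := iter n phi k; have [xE|xE] := boolP (x \in E).
    rewrite [X in X * _](_ : _ = 1 - eE x)// HeE xE subrr mul0r nrc0.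
    by rewrite invr_ge0 ltW.
  rewrite [X in X * _](_ : _ = 1 - eE x)// HeE (negbTE xE) subr0 mul1r.
  have /EF : (~` E) x by move=> Ex; rewrite mem_set in xE.
  by rewrite /= /wn' comp_iterE /x (iter_cancel (ws_phiK ws)) => /ltW.
have yEF : nr y <= nr (M eE y) + nr (M (1 - eE) y).
  rewrite -{1}[y]/((1 : 'L(Y)) y) -(ws_M1 ws) -[X in M X y](subrK eE) addrC ws_MDD.
  exact: nrD.
have cD0 : 0 <= c * D by rewrite mulr_ge0.
have h1 : (a n)^-1 * (nr (V1 ^+ n) * (nr y + c * D)) <= 4^-1 * (nr y + c * D).
  by rewrite mulrA ler_wpM2r// addr_ge0 ?nr_ge0.
have h2 : (a n)^-1 * nr (V ^+ n) * nr y <= 4^-1 * nr y by rewrite ler_wpM2r ?nr_ge0.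
rewrite -mulrA; move: hE hF yEF cD0 h1 h2; lra.
Qed.

End WeightedOperator.

(** * Wave packets on towers of disjoint clopen sets *)

Section WavePackets.
Context {R : realType} {K : topologicalType} {Y : normedModType R[i]}.
Local Notation CK := (continuousType K R[i]^o).
Variables (phi psi : continuousType K K) (M : CK -> 'L(Y)) (V V1 : 'L(Y)).
Hypothesis ws : weighted_setting phi psi M V V1.
Local Open Scope complex_scope.
Implicit Types (f g e w : CK) (z : Y) (l : R[i]).

Lemma cts_sumE n (F : nat -> CK) k : (\sum_(i < n) F i) k = \sum_(i < n) (F i k : R[i]).
Proof.
elim: n => [|n IH]; first by rewrite !big_ord0.
rewrite !big_ord_recr/= -IH.
by [].
Qed.

Lemma ws_M_sum n (F : nat -> CK) : M (\sum_(i < n) F i) = \sum_(i < n) M (F i).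
Proof.
elim: n => [|n IH]; first by rewrite !big_ord0 (ws_M0 ws).
by rewrite !big_ord_recr/= (ws_MDD ws) IH.
Qed.

Lemma bop_sumx n (F : nat -> 'L(Y)) z : (\sum_(i < n) F i) z = \sum_(i < n) F i z.
Proof. by elim: n => [|n IH]; rewrite ?big_ord0// !big_ord_recr/= -IH. Qed.

(** For [e] the indicator of [H], this takes the value [al j] on the level [phi^j(H)]. *)
Definition tower_fun L (al : nat -> R[i]) e : CK :=
  \sum_(j < L) al j *: comp_iter psi j e.

Definition separated L (G : set K) :=
  forall (l : nat) x, (0 < l <= L)%N -> G x -> ~ G (iter l phi x).

Lemma separated_eq L G i j x : separated L G -> (i <= L)%N -> (j <= L)%N ->
  G (iter i psi x) -> G (iter j psi x) -> i = j.
Proof.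
move=> sepG; wlog ij : i j / (i < j)%N => [W iL jL Gi Gj|].
  by have [ij|ij|//] := ltngtP i j; [exact: W|apply/esym/W].
move=> iL jL Gi Gj; exfalso; apply: (sepG (j - i)%N _ _ Gj).
  by rewrite subn_gt0 ij/=; exact: leq_trans (leq_subr _ _) jL.
have -> : iter j psi x = iter (j - i) psi (iter i psi x).
  by rewrite -iterD subnK// ltnW.
by rewrite (iter_cancel' (ws_psiK ws)).
Qed.

(** At each point at most one summand is nonzero. The resulting bound does not involve [L], which is
    the purpose of the towers. *)
Lemma tower_fun_le L al e G H (b : R) : separated L G -> H `<=` G ->
  (forall k, e k = (k \in H)%:R) -> 0 <= b -> (forall j, nrc (al j) <= b) ->
  forall k, nrc (tower_fun L al e k) <= b.
Proof.
move=> sepG HG He b0 alb k.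
have -> : tower_fun L al e k = \sum_(j < L) al j * (iter j psi k \in H)%:R.
  rewrite /tower_fun (cts_sumE L (fun j => al j *: comp_iter psi j e)).
  by apply: eq_bigr => j _; rewrite -He -comp_iterE.
have [[j jH]|nj] := pselect (exists j : 'I_L, iter j psi k \in H); last first.
  rewrite big1 ?nrc0// => j _; rewrite memNset ?mulr0// => jH.
  by apply: nj; exists j; exact: mem_set.
rewrite (bigD1 j)//= big1 ?addr0 => [|i ij].
  by rewrite jH mulr1.
rewrite memNset ?mulr0// => iH; move/eqP: ij; apply; apply/val_inj.
exact: separated_eq sepG (ltnW (ltn_ord i)) (ltnW (ltn_ord j)) (HG _ iH)
  (HG _ (set_mem jH)).
Qed.

(** [S^i] carries a vector supported on [H'] to one supported on [phi^i(H')]; it is thus enough to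
    test the multiplier on that level. *)
Lemma tower_component w j i e e' z (c : R[i]) : M e' z = z ->
  (forall x, e (iter j psi (iter i phi x)) * e' x = c * e' x) ->
  M (comp_iter psi j e) (((V * M w) ^+ i) z) = c *: ((V * M w) ^+ i) z.
Proof.
move=> e'z ec.
have H : M (comp_iter phi i (comp_iter psi j e)) z = c *: z.
  rewrite -{1}e'z -bopMx -(ws_MM ws) (_ : _ * e' = c *: e') ?(ws_MZ ws) ?bopZx ?e'z//.
  by apply: cts_ext => x; rewrite -[RHS]/(c * e' x) -ec -!comp_iterE.
rewrite (ws_power ws) -bopMx mulrA (ws_MVn ws) -mulrA (ws_M_comm ws) mulrA bopMx H.
exact: linearZ.
Qed.

Lemma indicator_idem (H H' : set K) e e' : H `<=` H' ->
  (forall k, e k = (k \in H)%:R) -> (forall k, e' k = (k \in H')%:R) -> e' * e = e.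
Proof.
move=> HH' He He'; apply: cts_ext => k.
rewrite [LHS](_ : _ = e' k * e k)// He He'.
have [kH|kH] := boolP (k \in H); last by rewrite mulr0.
by rewrite (mem_set (HH' _ (set_mem kH))) mulr1.
Qed.

Lemma supported_vector (H : set K) e : H !=set0 -> (forall k, e k = (k \in H)%:R) ->
  exists z, M e z = z /\ 0 < nr z.
Proof.
move=> [k Hk] He.
have [v Mv] : exists v, M e v <> 0.
  apply: contrapT => nv.
  have e0 : e = 0.
    apply: (ws_M_inj ws); apply: bopP => v.
    by apply: contrapT => Mv; apply: nv; exists v.
  have := He k; rewrite mem_set// e0 => /eqP.
  by rewrite [_ == _](_ : _ = (0 == 1 :> R[i]))// eq_sym oner_eq0.
exists (M e v); split; last exact: nr_gt0.
by rewrite -bopMx -(ws_MM ws) (indicator_idem _ He He).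
Qed.

Section Packet.
Variables (S : 'L(Y)) (N : nat) (q : R).

(** The exponent is the distance of [j] from [N]: one of the two truncated differences vanishes. *)
Definition packet_coef j : R := q ^+ ((N - j) + (j - N)).

Definition packet z : Y := \sum_(j < (N + N).+1) (packet_coef j)%:C *: (S ^+ j) z.

(** The increment of [packet_coef] at [j], relative to [packet_coef j]: increments of a packet thus
    become the packet under a tower multiplier. The value at 0 is 0 since the first term is listed
    apart in [packet_telescope]. *)
Let al j : R[i] := if j is j'.+1 then 1 - (packet_coef j' / packet_coef j)%:C else 0.

(** Up to the peak the relative increment is [1 - q], beyond it [(1 - q) / q] in modulus; hence
    [q >= 1/2] and the factor 2. *)
Lemma packet_coef_ratio j : 2^-1 <= q -> q < 1 -> nrc (al j) <= 2 * (1 - q).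
Proof.
move=> q2 q1; case: j => [|j]; first by rewrite nrc0; lra.
have q0 : 0 < q by lra.
rewrite /al -(rmorph1 (real_complex R)) -rmorphB nrcR.
have [jN|jN] := ltnP j N.
  have -> : packet_coef j / packet_coef j.+1 = q.
    rewrite /packet_coef (_ : N - j + (j - N) = (N - j.+1 + (j.+1 - N)).+1)%N; last lia.
    by rewrite exprS mulfK// gt_eqF// exprn_gt0.
  by rewrite ger0_norm; lra.
have -> : packet_coef j / packet_coef j.+1 = q^-1.
  rewrite /packet_coef (_ : N - j.+1 + (j.+1 - N) = (N - j + (j - N)).+1)%N; last lia.
  by rewrite exprSr invfM mulrA divff ?mul1r// gt_eqF// exprn_gt0.
have qi : q * q^-1 = 1 by rewrite divff// gt_eqF.
have qi1 : 1 < q^-1 by rewrite invf_gt1.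
by rewrite ler0_norm; nra.
Qed.

Lemma packet_telescope z : q != 0 ->
  packet z - S (packet z) = (q ^+ N)%:C *: z
    + \sum_(j < (N + N).+1) (al j * (packet_coef j)%:C) *: (S ^+ j) z
    - (q ^+ N)%:C *: (S ^+ (N + N).+1) z.
Proof.
move=> q0.
have c0 : packet_coef 0 = q ^+ N by rewrite /packet_coef subn0 sub0n addn0.
have c2N : packet_coef (N + N) = q ^+ N.
  by rewrite /packet_coef (_ : N - (N + N) + (N + N - N) = N)%N//; lia.
have alc j : al j.+1 * (packet_coef j.+1)%:C = (packet_coef j.+1)%:C - (packet_coef j)%:C.
  rewrite /al mulrBl mul1r -rmorphM/= divfK//.
  by rewrite /packet_coef expf_neq0.
rewrite -{1}c0 -c2N /packet; elim: (N + N)%N => [|m IH].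
  rewrite !big_ord_recr !big_ord0/= !add0r mul0r scale0r addr0.
  by rewrite linearZ.
have sumS (F : nat -> Y) : \sum_(j < m.+2) F j = \sum_(j < m.+1) F j + F m.+1.
  exact: big_ord_recr.
have SD x y : S (x + y) = S x + S y by exact: linearD.
have SS c : S (c *: (S ^+ m.+1) z) = c *: (S ^+ m.+2) z.
  by rewrite linearZ [in RHS]exprS bopMx.
rewrite (sumS (fun j => (packet_coef j)%:C *: (S ^+ j) z)).
rewrite (sumS (fun j => (al j * (packet_coef j)%:C) *: (S ^+ j) z)).
rewrite SD opprD addrACA IH alc scalerBl SS.
by rewrite -!addrA; congr (_ + (_ + _)); rewrite addrCA.
Qed.

End Packet.

(** Used with [d = 1] to change the coefficients of a packet by its own tower, and with [d = 0] to
    annihilate a packet built on a disjoint base. *)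
Lemma tower_action w L (al c : nat -> R[i]) G H H' e e' z (d : R[i]) :
  separated L G -> H `<=` G -> H' `<=` G ->
  (forall k, e k = (k \in H)%:R) -> (forall k, e' k = (k \in H')%:R) ->
  M e z = z -> (forall x, e' x * e x = d * e x) ->
  M (tower_fun L al e') (\sum_(i < L) c i *: ((V * M w) ^+ i) z) =
  d *: \sum_(j < L) (al j * c j) *: ((V * M w) ^+ j) z.
Proof.
move=> sepG HG HG' He He' ez ed; set S := V * M w.
rewrite /tower_fun (ws_M_sum L (fun j => al j *: comp_iter psi j e')).
rewrite (bop_sumx L (fun j => M (al j *: comp_iter psi j e'))) scaler_sumr.
apply: eq_bigr => j _; rewrite (ws_MZ ws) bopZx linear_sum (bigD1 j)//= big1 ?addr0.
  rewrite linearZ/= (@tower_component w j j e' e z d ez) => [|x]; last first.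
    by rewrite (iter_cancel (ws_phiK ws)).
  by rewrite !scalerA; congr (_ *: _); ring.
move=> i ij; rewrite linearZ/= (@tower_component w j i e' e z 0 ez) => [|x].
  by rewrite scale0r scaler0.
rewrite mul0r He He'; set x' := iter j psi _.
have [xH|xH] := boolP (x \in H); last by rewrite mulr0.
have [xH'|xH'] := boolP (x' \in H'); last by rewrite mul0r.
exfalso; move/eqP: ij; apply; apply/val_inj.
apply: (separated_eq sepG (ltnW (ltn_ord i)) (ltnW (ltn_ord j)) (x := iter i phi x)).
  by rewrite (iter_cancel (ws_phiK ws)); apply: HG; exact: set_mem.
by apply: HG'; exact: set_mem.
Qed.

(** The projection to level [N], of norm at most 1, recovers the peak term [u = S^N z] from [y].
    Both end terms of the telescoped residual are controlled by [u]: [z] by dividing by the cocycle,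
    and [S^(2N+1) z] as [S^(N+1) u]. They carry the factor [q^N], while the middle terms cost
    [2 (1 - q)]. *)
Lemma packet_estimate w N (q : R) G H e z : clopen G ->
  separated (N + N).+1 G -> H `<=` G -> (forall k, e k = (k \in H)%:R) ->
  M e z = z -> 2^-1 <= q -> q < 1 ->
  (forall x, G x -> 2^-1 <= nrc (cocycle phi w N x)) ->
  (forall x, G x -> nrc (cocycle phi w N.+1 (iter N phi x)) <= 2) ->
  let S := V * M w in let y := packet S N q z in
  nr z <= 2 * nr (V1 ^+ N) * nr y /\
  nr (y - S y) <= (2 * (1 - q) + q ^+ N * (2 * nr (V1 ^+ N) + 2 * nr (V ^+ N.+1))) * nr y.
Proof.
move=> Gc sepG HG He ez q2 q1 wN wN1 S y.
have q0 : 0 < q by lra.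
have e_le k : nrc (e k) <= 1 by rewrite He; case: (k \in H); rewrite ?nrc0 ?nrc1.
have ee x : e x * e x = 1 * e x.
  by rewrite mul1r He; case: (x \in H); rewrite ?mulr1 ?mulr0.
set u := (S ^+ N) z.
have eu : M (comp_iter psi N e) u = u.
  rewrite /u (@tower_component w N N e e z 1 ez) ?scale1r// => x.
  by rewrite (iter_cancel (ws_phiK ws)).
have act al := tower_action w al (fun j => (packet_coef N q j)%:C) sepG HG HG He He ez ee.
have uy : nr u <= nr y.
  have -> : u = M (tower_fun (N + N).+1 (fun j => (j == N)%:R) e) y.
    rewrite act scale1r.
    have Nlt : (N < (N + N).+1)%N by rewrite ltnS leq_addr.
    rewrite (bigD1 (Ordinal Nlt))//= big1 ?addr0 => [|j jN].
      by rewrite eqxx mul1r /packet_coef subnn addn0 expr0 rmorph1 scale1r.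
    rewrite (_ : (j : nat) == N = false) ?mul0r ?scale0r//.
    by apply/negbTE; apply: contra jN => /eqP jN; apply/eqP/val_inj.
  rewrite -[X in _ <= X]mul1r; apply: (ws_M_le ws) => //.
  apply: (tower_fun_le sepG HG He ler01) => j.
  by case: (j == N); rewrite ?nrc0 ?nrc1.
have zu : nr z <= 2 * nr (V1 ^+ N) * nr u.
  have h20 : 0 < 2^-1 :> R by rewrite invr_gt0 ltr0n.
  have [h Hh] := clopen_inverse (f := cocycle phi w N) Gc h20 wN.
  have -> : z = M h ((V1 ^+ N) u).
    rewrite /u (ws_power ws) -!bopMx -mulrA (mulrA (V1 ^+ N)) (ws_Vn_cancel ws) mul1r.
    rewrite -(ws_MM ws) -{1 2}ez -bopMx -(ws_MM ws); congr (M _ z).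
    apply: cts_ext => k; rewrite [RHS](_ : _ = h k * cocycle phi w N k * e k)// (Hh k).1 He.
    have [kH|kH] := boolP (k \in H); last by rewrite mulr0.
    by rewrite (mem_set (HG _ (set_mem kH))) mulr1.
  rewrite -mulrA; apply: le_trans (ws_M_le ws _ (ltW (ltr0Sn _ 1)) _) _.
    by move=> k; have := (Hh k).2; rewrite invrK.
  by rewrite ler_pM2l ?ltr0n// bop_nr.
have SNu : nr ((S ^+ (N + N).+1) z) <= 2 * nr (V ^+ N.+1) * nr u.
  rewrite -addSn exprD bopMx -/u (ws_power ws) bopMx.
  apply: le_trans (bop_nr _ _) _; rewrite [2 * _]mulrC -mulrA ler_wpM2l ?nr_ge0//.
  rewrite -{1}eu -bopMx -(ws_MM ws); apply: (ws_M_le ws) => // x.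
  rewrite [X in nrc X](_ : _ = cocycle phi w N.+1 x * comp_iter psi N e x)//.
  rewrite comp_iterE He; have [xH|xH] := boolP (_ \in _); last by rewrite mulr0 nrc0.
  have := wN1 _ (HG _ (set_mem xH)).
  by rewrite (iter_cancel' (ws_psiK ws)) mulr1.
have nV := nr_ge0 (V ^+ N.+1); have nV1 := nr_ge0 (V1 ^+ N).
have y0 := nr_ge0 y.
have qN : 0 <= q ^+ N by rewrite exprn_ge0// ltW.
split; first by apply: (le_trans zu); rewrite ler_wpM2l// mulr_ge0.
rewrite packet_telescope ?gt_eqF//.
set T := \sum_(j < _) _.
have nT : nr T <= 2 * (1 - q) * nr y.
  pose al j := if j is j'.+1
    then 1 - (packet_coef N q j' / packet_coef N q j)%:C else 0 : R[i].
  have -> : T = M (tower_fun (N + N).+1 al e) y by rewrite act scale1r.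
  apply: (ws_M_le ws); first by lra.
  by apply: (tower_fun_le sepG HG He); [lra|move=> j; exact: packet_coef_ratio].
have c1 : nr ((q ^+ N)%:C *: z) <= q ^+ N * (2 * nr (V1 ^+ N)) * nr y.
  rewrite nrZ nrcR ger0_norm// -mulrA ler_wpM2l//; apply: (le_trans zu).
  by rewrite ler_wpM2l// mulr_ge0.
have c2 : nr (- ((q ^+ N)%:C *: (S ^+ (N + N).+1) z)) <= q ^+ N * (2 * nr (V ^+ N.+1)) * nr y.
  rewrite nrN nrZ nrcR ger0_norm// -mulrA ler_wpM2l//; apply: (le_trans SNu).
  by rewrite ler_wpM2l// mulr_ge0.
apply: le_trans (nrD_le (nrD_le c1 nT) c2) _.
by rewrite le_eqVlt; apply/orP; left; apply/eqP; ring.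
Qed.

(** Disjointness of supports is encoded by multipliers [p i] of norm at most 1 that fix one vector
    and kill the others. *)
Definition approx_family (T : 'L(Y)) (l : R[i]) := forall (eps : R) (d : nat), 0 < eps ->
  exists (y : nat -> Y) (p : nat -> CK), forall i, (i < d)%N ->
    [/\ nr (y i) = 1, nr (l *: y i - T (y i)) <= eps,
        forall k, nrc (p i k) <= 1, M (p i) (y i) = y i &
        forall j, (j < d)%N -> j != i -> M (p i) (y j) = 0].

Lemma unit_normalize z : 0 < nr z -> nr ((nr z)^-1%:C *: z) = 1.
Proof.
by move=> z0; rewrite nrZ nrcR ger0_norm ?invr_ge0 ?nr_ge0// mulVf// gt_eqF.
Qed.

Section Approx.
Hypotheses (nper : periodic_points phi = set0) (niso : isolated [set: K] = set0).

Lemma indicator_family (G : set K) d : open G -> G !=set0 ->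
  exists (H : nat -> set K) (e : nat -> CK) (z : nat -> Y),
    (forall i, (i < d)%N -> [/\ H i `<=` G, forall k, e i k = (k \in H i)%:R,
      M (e i) (z i) = z i & 0 < nr (z i)]) /\
    (forall i j k, (i < d)%N -> (j < d)%N -> i != j -> e i k * e j k = 0).
Proof.
move=> oG G0.
have [H [HP Hdis]] := clopen_pieces (ws_compact ws) (ws_hausdorff ws)
  (ws_extremal ws) d niso oG G0.
have /choice[e He] : forall i, exists e : CK, (i < d)%N -> forall k, e k = (k \in H i)%:R.
  move=> i; have [id|] := ltnP i d; last by exists 0.
  by have [Hc _ _] := HP _ id; have [e He] := clopen_indic (R := R) Hc; exists e.
have /choice[z Hz] : forall i, exists z, (i < d)%N -> M (e i) z = z /\ 0 < nr z.
  move=> i; have [id|] := ltnP i d; last by exists 0.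
  have [_ H0 _] := HP _ id.
  by have [z Hz] := supported_vector H0 (He _ id); exists z.
exists H, e, z; split=> [i id|i j k id jd ij].
  by have [_ _ HG] := HP _ id; have [ez z0] := Hz _ id; split=> //; exact: He.
rewrite !He//; have [kH|] := boolP (k \in H i); last by rewrite mul0r.
have [kH'|] := boolP (k \in H j); last by rewrite mulr0.
by exfalso; move/eqP: ij; apply; exact: Hdis id jd (set_mem kH) (set_mem kH').
Qed.

Lemma unit_approx_family w : peak_orbit phi psi w 1 -> approx_family (V * M w) 1.
Proof.
move=> [k peak] eps d eps0.
(* This makes [eta] at most both [eps / 4] and 1/4. So [2 (1 - q) <= eps / 2], [q >= 1/2], and
   [q (1 + eta) < 1] lets [q^N] beat growth of rate [1 + eta]. *)
pose eta := eps / (4 * (1 + eps)).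
have eta0 : 0 < eta by rewrite divr_gt0// mulr_gt0//; lra.
have eta_eps : eta * (4 * (1 + eps)) = eps by rewrite divfK// gt_eqF// mulr_gt0//; lra.
have etaL : 4 * eta <= eps by nra.
have etaL1 : 4 * eta <= 1 by nra.
pose q := 1 - eta.
have rho1 : 1 < 1 + eta by lra.
have [C C0 VC] := ws_V_growth ws rho1.
have [C' C'0 VC'] := ws_V1_growth ws rho1.
have qr0 : 0 <= q * (1 + eta) by rewrite mulr_ge0 /q//; lra.
have qr1 : q * (1 + eta) < 1 by rewrite /q; nra.
pose B := 2 * C' + 2 * C * (1 + eta).
have B0 : 0 < B by rewrite addr_gt0 ?mulr_gt0//; lra.
have [N /(_ N (leqnn N)) HN] := pow_small qr0 qr1 (divr_gt0 eps0 (mulr_gt0 (ltr0n R 2) B0)).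
(* The peak condition bounds the [N]-cocycle below by 1 at [b] and the [N.+1]-cocycle above by 1 at
   [k]; relaxing to 1/2 and 2 makes both conditions open. *)
pose b := iter N psi k.
have nbO : nbhs b ([set x | 2^-1 < nrc (cocycle phi w N x)] `&`
    [set x | nrc (comp_iter phi N (cocycle phi w N.+1) x) < 2]).
  have [_ p2] := peak N; have [p1 _] := peak N.+1.
  rewrite nrc1 !expr1n in p1 p2.
  apply: filterI; apply: open_nbhs_nbhs; split.
  - exact: open_nrc_gt.
  - by apply: lt_le_trans p2; rewrite invf_lt1// ltr1n.
  - exact: open_nrc_lt.
  - rewrite /= comp_iterE /b (iter_cancel' (ws_psiK ws)).
    by apply: le_lt_trans p1 _; rewrite ltr1n.
have [G [Gc Gb GO sepG]] := clopen_disjoint_iter (ws_compact ws) (ws_hausdorff ws)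
  (ws_extremal ws) (N + N).+1 nper nbO.
have [|H [e [z [HP dis]]]] := @indicator_family G d Gc.1; first by exists b.
have q2 : 2^-1 <= q by rewrite /q; lra.
have q1 : q < 1 by rewrite /q; lra.
have q0 : 0 <= q by lra.
have wN x : G x -> 2^-1 <= nrc (cocycle phi w N x) by move=> /GO[/ltW].
have wN1 x : G x -> nrc (cocycle phi w N.+1 (iter N phi x)) <= 2.
  by move=> /GO[_]; rewrite /= comp_iterE => /ltW.
pose S := V * M w; pose y i := packet S N q (z i).
have est i : (i < d)%N -> 0 < nr (y i) /\ nr (y i - S (y i)) <= eps * nr (y i).
  move=> id; have [HG He ez z0] := HP _ id.
  have [zy yS] := packet_estimate Gc sepG HG He ez q2 q1 wN wN1.
  rewrite -/S -/(y i) in zy yS.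
  split.
    rewrite lt0r nr_ge0 andbT; apply/eqP => y0.
    by move: zy; rewrite y0 mulr0 leNgt z0.
  apply: (le_trans yS); rewrite ler_wpM2r ?nr_ge0//.
  have qN : 0 <= q ^+ N by rewrite exprn_ge0.
  have : q ^+ N * (2 * nr (V1 ^+ N) + 2 * nr (V ^+ N.+1)) <= (q * (1 + eta)) ^+ N * B.
    rewrite exprMn -mulrA ler_wpM2l// /B mulrDr.
    have := VC N.+1; have := VC' N; rewrite [(1 + eta) ^+ N.+1]exprS.
    by set X := (1 + eta) ^+ N => h1 h2; lra.
  have : (q * (1 + eta)) ^+ N * B <= eps / 2.
    by rewrite -ler_pdivlMr// -mulrA -invfM; exact: ltW.
  by rewrite /q; lra.
exists (fun i => (nr (y i))^-1%:C *: y i), (fun i => tower_fun (N + N).+1 (fun=> 1) (e i)).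
move=> i id; have [yi0 yiS] := est _ id; have [HG He ez z0] := HP _ id.
split.
- exact: unit_normalize.
- rewrite scale1r linearZ/= -scalerBr nrZ nrcR ger0_norm ?invr_ge0 ?nr_ge0//.
  by rewrite mulrC ler_pdivrMr.
- by apply: (tower_fun_le sepG HG He ler01) => j; rewrite nrc1.
- have ee x : e i x * e i x = 1 * e i x.
    by rewrite mul1r He; case: (x \in H i); rewrite ?mulr1 ?mulr0.
  have act := tower_action w (fun=> 1) (fun j => (packet_coef N q j)%:C)
    sepG HG HG He He ez ee.
  rewrite linearZ; congr (_ *: _); apply: etrans act _.
  by rewrite scale1r; apply: eq_bigr => j _; rewrite mul1r.
- move=> j jd ji; have [HGj Hej ezj _] := HP _ jd.
  have ee x : e i x * e j x = 0 * e j x by rewrite mul0r dis// eq_sym.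
  have act := tower_action w (fun=> 1) (fun j => (packet_coef N q j)%:C)
    sepG HGj HG Hej He ezj ee.
  rewrite scale0r in act; rewrite linearZ -[RHS](scaler0 _ (nr (y j))^-1%:C).
  by congr (_ *: _); exact: act.
Qed.

Lemma zero_approx_family w : peak_orbit phi psi w 0 -> approx_family (V * M w) 0.
Proof.
move=> [k peak] eps d eps0.
(* For [l = 0] a peak means a zero of the weight, and vectors supported near it are almost
   annihilated. *)
have [+ _] := peak 1%N; rewrite cocycle1 nrc0 expr1 => wk.
pose c := eps / (1 + nr V).
have V0 : 0 < 1 + nr V by have := nr_ge0 V; lra.
have c0 : 0 < c by rewrite divr_gt0.
have [|H [e [z [HP dis]]]] := @indicator_family [set x | nrc (w x) < c] d (open_nrc_lt w c).
  by exists k; exact: le_lt_trans c0.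
exists (fun i => (nr (z i))^-1%:C *: z i), e => i id.
have [HG He ez z0] := HP _ id; split.
- exact: unit_normalize.
- have : nr (M (w * e i) (z i)) <= c * nr (z i).
    apply: (ws_M_le ws); first exact: ltW.
    move=> x; rewrite [X in nrc X](_ : _ = w x * e i x)// He.
    have [xH|xH] := boolP (x \in H i); last by rewrite mulr0 nrc0 ltW.
    by rewrite mulr1 ltW//; apply: HG; exact: set_mem.
  rewrite (ws_MM ws) bopMx ez => h.
  have : nr ((V * M w) (z i)) <= eps * nr (z i).
    rewrite bopMx; apply: (le_trans (bop_nr _ _)).
    apply: le_trans (_ : (1 + nr V) * (c * nr (z i)) <= _).
      by rewrite ler_pM ?nr_ge0//; have := nr_ge0 V; lra.
    by rewrite mulrA [_ * c]mulrC divfK// gt_eqF.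
  move=> h2; rewrite scale0r sub0r nrN linearZ nrZ nrcR ger0_norm ?invr_ge0 ?nr_ge0//.
  by rewrite mulrC ler_pdivrMr.
- by move=> x; rewrite He; case: (x \in H i); rewrite ?nrc0 ?nrc1.
- by rewrite linearZ/= ez.
- move=> j jd ji; have [_ Hej ezj _] := HP _ jd.
  rewrite linearZ/= -ezj -bopMx -(ws_MM ws) (_ : _ * _ = 0) ?(ws_M0 ws) ?scaler0//.
  by apply: cts_ext => x; rewrite [LHS](_ : _ = e i x * e j x)// dis// eq_sym.
Qed.

Lemma peak_orbit_scale w l : l != 0 ->
  peak_orbit phi psi (l^-1 *: w) 1 <-> peak_orbit phi psi w l.
Proof.
move=> l0; have nl : 0 < nrc l by rewrite lt0r nrc_ge0 nrc_eq0 l0.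
by split=> -[k Hk]; exists k => n; have [h1 h2] := Hk n; move: h1 h2;
  rewrite !cocycleZ !nrcM !nrcX nrcV nrc1 expr1n exprVn
    ler_pdivrMl ?exprn_gt0// ler_pdivlMl ?exprn_gt0// !mulr1.
Qed.

Lemma ws_scale w (l : R[i]) : V * M (l^-1 *: w) = l^-1 *: (V * M w).
Proof. by rewrite (ws_MZ ws) bop_scaler. Qed.

Lemma scaled_residual w l z : l != 0 ->
  l *: z - (V * M w) z = l *: (z - (V * M (l^-1 *: w)) z).
Proof. by move=> l0; rewrite ws_scale scalerBr scalerA divff// scale1r. Qed.

Lemma peak_approx_family w l : peak_orbit phi psi w l -> approx_family (V * M w) l.
Proof.
have [->|l0] := eqVneq l 0; first exact: zero_approx_family.
have nl : 0 < nrc l by rewrite lt0r nrc_ge0 nrc_eq0 l0.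
move=> /(peak_orbit_scale _ l0)/unit_approx_family H eps d eps0.
have [y [p yp]] := H _ d (divr_gt0 eps0 nl).
exists y, p => i /yp[y1 yS p1 py pyj]; split=> //.
by rewrite scaled_residual// nrZ mulrC -ler_pdivlMr//; move: yS; rewrite scale1r.
Qed.

End Approx.

Lemma no_peak_bounded_below w l : ~ peak_orbit phi psi w l ->
  exists2 C : R, 0 < C & forall y, nr y <= C * nr (l *: y - (V * M w) y).
Proof.
suff H : ~ peak_orbit phi psi w l ->
    exists C : R, forall y, nr y <= C * nr (l *: y - (V * M w) y).
  move=> /H[C HC]; exists (1 + `|C|) => [|y]; first by have := normr_ge0 C; lra.
  apply: (le_trans (HC y)); rewrite ler_wpM2r ?nr_ge0//.
  by have := ler_norm C; lra.
have [->|l0] := eqVneq l 0; last first.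
  move=> np; have nl : 0 < nrc l by rewrite lt0r nrc_ge0 nrc_eq0 l0.
  have [|C HC] := unit_bounded_below ws (w := l^-1 *: w).
    by move/(peak_orbit_scale _ l0).
  exists (C / nrc l) => y; rewrite scaled_residual// nrZ mulrA divfK ?gt_eqF//.
move=> np.
(* A zero of [w] would be a peak orbit for [l = 0], with the case [n = 0] holding because
   [0 ^ 0 = 1]. Compactness then bounds [w] away from zero, and [w] is inverted. *)
have w0 k : 0 < nrc (w k).
  rewrite lt0r nrc_ge0 andbT; apply/eqP => wk; apply: np; exists k => -[|n].
    have c0 x : cocycle phi w 0 x = 1 by [].
    by rewrite !expr0 !c0 nrc1.
  rewrite -add1n cocycleD cocycle1 nrcM wk mul0r nrc0 expr0n/=.
  by split=> //; exact: nrc_ge0.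
have [a a0 wa] : exists2 a : R, 0 < a & forall k, a <= nrc (w k).
  have /compact_near_coveringP Kc := ws_compact ws.
  have : \forall N \near \oo, [set: K] `<=` [set k | N.+1%:R^-1 < nrc (w k)].
    apply: Kc => k _.
    have k2 : 0 < nrc (w k) / 2 by rewrite divr_gt0.
    exists ([set x | nrc (w k) / 2 < nrc (w x)], [set N | N.+1%:R^-1 < nrc (w k) / 2]).
      split=> /=; last exact: near_natSinv.
      apply: open_nbhs_nbhs; split; first exact: open_nrc_gt.
      by rewrite /= ltr_pdivrMr// ltr_pMr// ltr1n.
    by move=> [x N] [/= h1 h2]; exact: lt_trans h2 h1.
  move=> [N _ /(_ N (leqnn N)) HN]; exists N.+1%:R^-1; first by rewrite invr_gt0 ltr0n.
  by move=> k; apply: ltW; exact: HN.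
have Tc : clopen [set: K] by split; [exact: openT|exact: closedT].
have [h Hh] := clopen_inverse (f := w) Tc a0 (fun k _ => wa k).
exists (a^-1 * nr V1) => y; rewrite scale0r sub0r nrN.
have {1}-> : y = M h (V1 ((V * M w) y)).
  rewrite -!bopMx -mulrA (mulrA V1) (ws_V1V ws) mul1r -(ws_MM ws).
  rewrite (_ : h * w = 1) ?(ws_M1 ws)//; apply: cts_ext => k.
  by rewrite [LHS](_ : _ = h k * w k)// (Hh k).1 in_setT.
have ai0 : 0 <= a^-1 by rewrite invr_ge0 ltW.
apply: le_trans (ws_M_le ws _ ai0 (fun k => (Hh k).2)) _.
by rewrite -mulrA ler_wpM2l// bop_nr.
Qed.

End WavePackets.

(** * Closed range and the open mapping theorem *)

Section ClosedRange.
Context {R : realType} {Y : normedModType R[i]}.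
Local Open Scope complex_scope.
Implicit Types (A : set Y) (y z h : Y) (e : nat -> R).

(** The form of completeness in which [dual_complete] delivers the dual, which is typed only as a
    normed space. *)
Definition seq_complete := forall (g : nat -> Y) e, vanishing e ->
  (forall i j, nr (g i - g j) <= e i + e j) ->
  exists h, forall i, nr (g i - h) <= e i * 2.

Lemma closed_approx A h : closed A ->
  (forall d : R, 0 < d -> exists2 a, A a & nr (a - h) <= d) -> A h.
Proof.
move=> cA Ah; apply: cA => B /nbhs_ballP[d /= d0 dB].
have dE : d = (complex.Re d)%:C by rewrite RRe_real// gtr0_real.
have d'0 : 0 < complex.Re d by rewrite -ltcR -dE.
have [a Aa ah] := Ah _ (divr_gt0 d'0 (ltr0n R 2)).
exists a; split=> //; apply: dB; rewrite -ball_normE /= distrC dE nrE ltcR.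
by apply: (le_lt_trans ah); rewrite ltr_pdivrMr// ltr_pMr// ltr1n.
Qed.

Lemma approx_closed A :
  (forall h, (forall d : R, 0 < d -> exists2 a, A a & nr (a - h) <= d) -> A h) -> closed A.
Proof.
move=> H h clh; apply: H => d d0.
have [|a [Aa ah]] := clh (ball h d%:C).
  by apply: nbhsx_ballx; rewrite ltcR.
exists a => //; move: ah; rewrite -ball_normE /= distrC nrE ltcR; exact: ltW.
Qed.

Lemma vanishing_geometric (c : R) : 0 <= c -> vanishing (fun i => c * 2^-1 ^+ i).
Proof.
move=> c0 d d0; have c1 : 0 < c + 1 by lra.
have h0 : 0 <= 2^-1 :> R by rewrite invr_ge0 ler0n.
have h1 : 2^-1 < 1 :> R by rewrite invf_lt1// ltr1n.
have [n /(_ n (leqnn n)) Hn] := pow_small h0 h1 (divr_gt0 d0 c1).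
exists n; rewrite mulrC; move: Hn; rewrite ltr_pdivlMr//; apply: le_lt_trans.
by rewrite ler_wpM2l ?exprn_ge0//; lra.
Qed.

Lemma bounded_below_closed_range (T : 'L(Y)) (C : R) : seq_complete -> 0 < C ->
  (forall y, nr y <= C * nr (T y)) -> closed (range T).
Proof.
move=> Yc C0 HC; apply: approx_closed => h Hh.
have /choice[y Hy] : forall i, exists y, nr (T y - h) <= 2^-1 ^+ i.
  move=> i; have [|_ [y _ <-] yh] := Hh (2^-1 ^+ i); first by rewrite exprn_gt0// invr_gt0 ltr0n.
  by exists y.
have [||y0 Hy0] := Yc y (fun i => C * 2^-1 ^+ i).
- exact/vanishing_geometric/ltW.
- move=> i j; apply: (le_trans (HC _)); rewrite -mulrDr ler_pM2l// bop_sub.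
  rewrite -(subrK h (T (y i))) -addrA; apply: nrD_le => //.
  by rewrite nrB.
exists y0 => //; apply/eqP; rewrite -subr_eq0; apply/eqP.
apply: (@vanishing_eq0 _ _ _ (fun i => 1 * 2^-1 ^+ i) (1 + nr T * C * 2)).
- by rewrite addr_ge0 ?mulr_ge0 ?nr_ge0// ltW.
- exact: vanishing_geometric.
move=> i; rewrite mul1r mulrDr mulr1 [leRHS]addrC.
rewrite -(subrK (T (y i)) (T y0)) -addrA; apply: nrD_le => //.
rewrite -bop_sub; apply: (le_trans (bop_nr _ _)).
rewrite [leRHS](_ : _ = nr T * (C * 2^-1 ^+ i * 2)); last by ring.
by rewrite ler_wpM2l ?nr_ge0// nrB.
Qed.

Section OpenMapping.
Variable T : 'L(Y).
Hypotheses (Yc : seq_complete) (Tc : closed (range T)).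

(* Baire's argument on the closed range, covered by the images of the balls of
   radius n. *)
Lemma range_somewhere_dense : exists (n : nat) (r : R) z0, [/\ 0 < r, range T z0 &
  forall z, range T z -> nr (z - z0) <= r -> forall d : R, 0 < d ->
    exists2 y, nr y <= n%:R & nr (z - T y) <= d].
Proof.
apply: contrapT => nd.
have step (n : nat) (s : Y * R) : exists s' : Y * R, range T s.1 -> 0 < s.2 ->
    [/\ range T s'.1, 0 < s'.2, nr (s'.1 - s.1) <= s.2 / 4, s'.2 <= s.2 / 2 &
        forall y, nr y <= n%:R -> s'.2 < nr (s'.1 - T y)].
  have [[Ts1 s20]|ns] := pselect (range T s.1 /\ 0 < s.2); last first.
    by exists s => Ts s2; exfalso; apply: ns.
  apply: contrapT => ns; apply: nd; exists n, (s.2 / 4), s.1; split=> //.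
    by rewrite divr_gt0.
  move=> z Tz zs d d0; apply: contrapT => ny.
  apply: ns; exists (z, Num.min d (s.2 / 2)) => _ _; split=> //=.
  - by rewrite lt_min d0 divr_gt0.
  - by rewrite ge_min lexx orbT.
  move=> y yn; rewrite ltNge; apply/negP => zd; apply: ny; exists y => //.
  by apply: (le_trans zd); rewrite ge_min lexx.
have /choice[F HF] : forall ns : nat * (Y * R), exists s' : Y * R,
    range T ns.2.1 -> 0 < ns.2.2 ->
    [/\ range T s'.1, 0 < s'.2, nr (s'.1 - ns.2.1) <= ns.2.2 / 4, s'.2 <= ns.2.2 / 2 &
        forall y, nr y <= ns.1%:R -> s'.2 < nr (s'.1 - T y)].
  by move=> [n s]; exact: step.
pose st := fix st n := if n is n'.+1 then F (n', st n') else (0 : Y, 1 : R).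
have stP n : range T (st n).1 /\ 0 < (st n).2.
  elim: n => [|n [IH1 IH2]]; first by split=> //=; exists 0; rewrite ?linear0.
  by have [] := HF (n, st n) IH1 IH2.
have st_step n := HF (n, st n) (stP n).1 (stP n).2.
have st_r n : (st n).2 <= 1 * 2^-1 ^+ n.
  elim: n => [|n IH]; first by rewrite expr0 mulr1.
  have [_ _ _ h _] := st_step n; apply: (le_trans h).
  by rewrite exprSr mulrA ler_wpM2r ?invr_ge0 ?ler0n.
have st_dist i k : nr ((st i).1 - (st (i + k)%N).1) <= (st i).2 / 2.
  elim: k i => [|k IH] i.
    by rewrite addn0 subrr nr0 divr_ge0// ltW// (stP i).2.
  rewrite addnS -addSn -(subrK (st i.+1).1 (st i).1) -addrA.
  have [_ _ h1 h2 _] := st_step i.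
  apply: le_trans (nrD_le (_ : _ <= (st i).2 / 4) (IH i.+1)) _; first by rewrite nrB.
  rewrite /= in h2 *; move: h2; lra.
(* In total the later centres move by at most half the current radius, so the limit lies within
   every radius and is missed by the image of every ball. *)
have [||h Hh] := Yc (g := fun i => (st i).1) (e := fun i => (st i).2 / 2).
- move=> d d0; have [n Hn] := vanishing_geometric ler01 d0; exists n.
  apply: le_lt_trans Hn; apply: le_trans (st_r n).
  by have := (stP n).2; lra.
- have st2 i : 0 <= (st i).2 / 2 by rewrite divr_ge0// ltW// (stP i).2.
  move=> i j; have [ij|ji] := leqP i j.
    by rewrite -(subnKC ij); apply: (le_trans (st_dist _ _)); rewrite lerDl.
  rewrite nrB -(subnKC (ltnW ji)); apply: (le_trans (st_dist _ _)).
  by rewrite lerDr.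
have [y _ yh] : range T h.
  apply: (closed_approx Tc) => d d0.
  have [n Hn] := vanishing_geometric ler01 d0.
  exists (st n).1; first exact: (stP n).1.
  apply: (le_trans (Hh n)); apply: le_trans (ltW Hn); apply: le_trans (st_r n).
  by rewrite divfK ?pnatr_eq0.
have [n yn] : exists n : nat, nr y <= n%:R.
  by exists (Num.bound (nr y)); apply/ltW/archi_boundP/nr_ge0.
have [_ _ _ _ /(_ y yn)] := st_step n.
rewrite yh -/(st n.+1) ltNge; have := Hh n.+1.
by rewrite divfK ?pnatr_eq0// => ->.
Qed.

(** The differences of approximate preimages of [z0 + t z] and [z0], divided by [t = r / nr z]: two
    errors [r / 4] become [nr z / 2]. *)
Lemma half_preimage : exists2 C : R, 0 <= C & forall z, range T z ->
  exists2 y, nr y <= C * nr z & nr (z - T y) <= nr z / 2.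
Proof.
have [n [r [z0 [r0 Tz0 H]]]] := range_somewhere_dense.
exists (2 * n%:R / r); first by rewrite divr_ge0 ?mulr_ge0// ltW.
move=> z Tz; have [z00|z00] := eqVneq (nr z) 0.
  by exists 0; rewrite ?nr0 z00 ?mulr0// linear0 subr0 z00 mul0r.
have zp : 0 < nr z by rewrite lt0r z00 nr_ge0.
pose t := r / nr z; have t0 : 0 < t by rewrite divr_gt0.
have d0 : 0 < r / 4 by rewrite divr_gt0.
have [||y1 y1n Hy1] := H (z0 + t%:C *: z) _ _ _ d0.
- have [a _ <-] := Tz0; have [b _ <-] := Tz.
  by exists (a + t%:C *: b) => //; rewrite linearD linearZ.
- by rewrite addrAC subrr add0r nrZ nrcR gtr0_norm// divfK.
have z0z0 : nr (z0 - z0) <= r by rewrite subrr nr0 ltW.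
have [y2 y2n Hy2] := H z0 Tz0 z0z0 _ d0.
have tn : nrc t^-1%:C = t^-1 by rewrite nrcR ger0_norm// invr_ge0 ltW.
exists (t^-1%:C *: (y1 - y2)).
  rewrite nrZ tn [leRHS](_ : _ = t^-1 * (n%:R + n%:R)).
    rewrite ler_pM2l ?invr_gt0//; apply: nrD_le => //.
    by rewrite nrN.
  by rewrite /t invf_div; field; rewrite !gt_eqF.
have -> : z - T (t^-1%:C *: (y1 - y2)) =
    t^-1%:C *: ((z0 + t%:C *: z - T y1) + (T y2 - z0)).
  rewrite bop_smul bop_sub !scalerDr scalerA -rmorphM/= mulVf ?gt_eqF// rmorph1 scale1r.
  rewrite !scalerN; set a := _ *: z0; set b := _ *: T y1; set c := _ *: T y2.
  rewrite opprB (addrC a z) (addrAC z a) (addrC c (- a)) (addrC c (- b)).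
  by rewrite (addrA (z - b + a)) addrK addrA.
rewrite nrZ tn; apply: le_trans (_ : t^-1 * (r / 4 + r / 4) <= _).
  rewrite ler_pM2l ?invr_gt0//; apply: nrD_le => //.
  by rewrite nrB.
rewrite /t invf_div le_eqVlt; apply/orP; left; apply/eqP; field.
by rewrite gt_eqF.
Qed.

(** The remainder left by [half_preimage] is treated again; the corrections form a geometric series.
    The constant [4 * C] comes from the error bound at index 0, and adding 1 makes it positive. *)
Lemma bounded_preimage : exists2 C : R, 0 < C & forall z, range T z ->
  exists2 y, T y = z & nr y <= C * nr z.
Proof.
have [C C0 HC] := half_preimage.
exists (4 * C + 1) => [|z Tz]; first by lra.
have /choice[G HG] : forall z, exists y, range T z ->
    nr y <= C * nr z /\ nr (z - T y) <= nr z / 2.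
  move=> z'; have [Tz'|nT] := pselect (range T z'); last by exists 0.
  by have [y h1 h2] := HC _ Tz'; exists y.
pose zs := fix zs n := if n is n'.+1 then zs n' - T (G (zs n')) else z.
have zsT n : range T (zs n).
  elim: n => //= n [a _ <-]; exists (a - G (T a)) => //; exact: bop_sub.
have zs_le n : nr (zs n) <= nr z * 2^-1 ^+ n.
  elim: n => [|n IH]; first by rewrite expr0 mulr1.
  have [_ h] := HG _ (zsT n); apply: (le_trans h).
  by rewrite exprSr mulrA ler_wpM2r ?invr_ge0 ?ler0n.
pose s n := \sum_(i < n) G (zs i).
have s_rec n : s n.+1 = s n + G (zs n) by rewrite /s big_ord_recr.
have zsE n : zs n = z - T (s n).
  elim: n => [|n IH]; first by rewrite /s big_ord0 linear0 subr0.
  by rewrite s_rec linearD/= opprD addrA -IH.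
have e0 i : 0 <= 2 * C * nr z * 2^-1 ^+ i.
  by rewrite !mulr_ge0 ?nr_ge0 ?exprn_ge0 ?invr_ge0 ?ler0n.
have s_dist i k : nr (s i - s (i + k)%N) <= 2 * C * nr z * 2^-1 ^+ i.
  elim: k i => [|k IH] i.
    by rewrite addn0 subrr nr0; exact: e0.
  rewrite addnS -addSn -(subrK (s i.+1) (s i)) -addrA.
  have g : nr (s i - s i.+1) <= C * nr z * 2^-1 ^+ i.
    rewrite s_rec opprD addrA subrr add0r nrN; have [h _] := HG _ (zsT i).
    by apply: (le_trans h); rewrite -mulrA ler_wpM2l ?zs_le.
  apply: le_trans (nrD_le g (IH i.+1)) _.
  by rewrite exprS le_eqVlt; apply/orP; left; apply/eqP; field.
have cz : 0 <= 2 * C * nr z by rewrite !mulr_ge0 ?nr_ge0.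
have [||h Hh] := Yc (g := s) (e := fun i => 2 * C * nr z * 2^-1 ^+ i).
- exact: vanishing_geometric.
- move=> i j; have [ij|ji] := leqP i j.
    by rewrite -(subnKC ij); apply: (le_trans (s_dist _ _)); rewrite lerDl.
  rewrite nrB -(subnKC (ltnW ji)); apply: (le_trans (s_dist _ _)).
  by rewrite lerDr.
exists h.
  apply/esym/eqP; rewrite -subr_eq0; apply/eqP.
  apply: (@vanishing_eq0 _ _ _ (fun i => 1 * 2^-1 ^+ i) (nr z + nr T * (4 * C * nr z))).
  - by rewrite addr_ge0 ?mulr_ge0 ?nr_ge0.
  - exact: vanishing_geometric.
  move=> i; rewrite mul1r mulrDr.
  rewrite -{1}(subrK (T (s i)) z) -addrA; apply: nrD_le.
    by rewrite -zsE mulrC zs_le.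
  rewrite -bop_sub; apply: (le_trans (bop_nr _ _)).
  rewrite [leRHS](_ : _ = nr T * (2 * C * nr z * 2^-1 ^+ i * 2)); last by ring.
  by rewrite ler_wpM2l ?nr_ge0.
have := Hh 0; rewrite /s big_ord0 sub0r nrN expr0 mulr1 => h1.
apply: (le_trans h1); rewrite mulrDl mul1r.
have := nr_ge0 z; set v := C * nr z; rewrite -!mulrA -/v; lra.
Qed.

End OpenMapping.
End ClosedRange.

(** * Both spectra as the set of peak values *)

Section FredholmSpectrum.
Context {R : realType} {K : topologicalType} {Y : normedModType R[i]}.
Local Notation CK := (continuousType K R[i]^o).
Variables (phi psi : continuousType K K) (M : CK -> 'L(Y)) (V V1 : 'L(Y)).
Hypothesis ws : weighted_setting phi psi M V V1.
Hypotheses (nper : periodic_points phi = set0) (niso : isolated [set: K] = set0).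
Local Open Scope complex_scope.
Implicit Types (w : CK) (l : R[i]).

Lemma residualE (T : 'L(Y)) l y : (l *: (1 : 'L(Y)) - T) y = l *: y - T y.
Proof. by []. Qed.

Lemma no_peak_sigma2 w l : seq_complete (Y := Y) ->
  ~ peak_orbit phi psi w l -> ~ sigma2 (V * M w) l.
Proof.
move=> Yc np; have [C C0 HC] := no_peak_bounded_below ws np.
apply; split; first exact: (@bounded_below_closed_range _ _ (l *: (1 : 'L(Y)) - V * M w) C).
exists 0%N, (fun=> 0); apply/seteqP; split=> [x Dx|_ [c _ <-]]; last first.
  by rewrite big_ord0; exact: linear0.
have {}Dx : (l *: (1 : 'L(Y)) - V * M w) x = 0 := Dx.
exists (fun=> 0) => //; rewrite big_ord0; apply/esym/nr0_eq0/eqP.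
rewrite eq_le nr_ge0 andbT; apply: (le_trans (HC x)).
by rewrite -residualE Dx nr0 mulr0.
Qed.

(** The coordinates form an [n.+1] by [n] matrix, which has a nonzero left kernel vector. *)
Lemma linear_dependence n (e : 'I_n -> Y) (x : nat -> Y) :
  (forall i, (i < n.+1)%N -> exists c, x i = \sum_(j < n) c j *: e j) ->
  exists a : nat -> R[i], (exists2 i, (i < n.+1)%N & a i != 0) /\
    \sum_(i < n.+1) a i *: x i = 0.
Proof.
move=> xc; have /choice[c Hc] : forall i : 'I_n.+1, exists c, x i = \sum_(j < n) c j *: e j.
  by move=> i; exact: xc.
pose A : 'M[R[i]]_(n.+1, n) := \matrix_(i, j) c i j.
have /rowV0Pn[a aA a0] : kermx A != 0.
  rewrite kermx_eq0; apply/negP => /eqP rA.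
  by have := rank_leq_col A; rewrite rA ltnn.
exists (fun i => a 0 (inord i)); split.
  apply: contrapT => na; move/eqP: a0; apply; apply/rowP => i; rewrite mxE.
  by apply/eqP/negPn/negP => ai; apply: na; exists i => //; rewrite inord_val.
transitivity (\sum_(j < n) (a *m A) 0 j *: e j); last first.
  by move/sub_kermxP: aA => ->; rewrite big1// => j _; rewrite mxE scale0r.
transitivity (\sum_(i < n.+1) \sum_(j < n) (a 0 i * c i j) *: e j).
  apply: eq_bigr => i _; rewrite inord_val Hc scaler_sumr.
  by apply: eq_bigr => j _; rewrite scalerA.
rewrite exchange_big; apply: eq_bigr => j _; rewrite mxE scaler_suml.
by apply: eq_bigr => i _; rewrite mxE.
Qed.

(* More almost-eigenvectors with disjoint supports than the dimension of the
   kernel: they would all be close to the kernel, hence almost dependent. *)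
Lemma peak_sigma2 w l : seq_complete (Y := Y) ->
  peak_orbit phi psi w l -> sigma2 (V * M w) l.
Proof.
move=> Yc /(peak_approx_family ws nper niso) fam [cD [n [e He]]].
set D := l *: _ - _ in cD He.
have [C C0 HC] := bounded_preimage Yc cD.
pose eps := (2 * C * n.+1%:R)^-1.
have n0 : 0 < n.+1%:R :> R by rewrite ltr0n.
have eps0 : 0 < eps by rewrite invr_gt0 !mulr_gt0.
have ce (r : R) : 0 < r -> C * (2 * C * r)^-1 * r = 2^-1.
  by move=> r0; field; rewrite !gt_eqF.
have [y [p yp]] := fam eps n.+1 eps0.
have /choice[u Hu] : forall i, exists u, (i < n.+1)%N ->
    D u = D (y i) /\ nr u <= C * eps.
  move=> i; have [id|] := ltnP i n.+1; last by exists 0.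
  have [|u Du nu] := HC (D (y i)); first by exists (y i).
  exists u => _; split=> //; apply: (le_trans nu); rewrite ler_pM2l//.
  by have [_ h _ _ _] := yp i id.
have [i id|a [[i1 i1n ai1] Ha]] := @linear_dependence n e (fun i => y i - u i).
  have [Du _] := Hu i id.
  have Dyu : D (y i - u i) = 0 by rewrite bop_sub Du subrr.
  have : [set x | D x = 0] (y i - u i) := Dyu.
  by rewrite He => -[c _ <-]; exists c.
(* With [a i0] largest and [nr (u i) <= 1 / (2 (n+1))], the sum of the [a i *: y i] has norm at most
   half of [nrc (a i0)]; yet the multiplier [p i0] sends it to [a i0 *: y i0], of norm
   [nrc (a i0)]. *)
have [i0 i0n Hi0] := nat_argmax (fun i => nrc (a i)) n.
have i0n' : (i0 < n.+1)%N by [].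
have a0 : 0 < nrc (a i0).
  by apply: lt_le_trans (Hi0 i1 i1n); rewrite lt0r nrc_ge0 nrc_eq0 ai1.
pose z := \sum_(i < n.+1) a i *: y i.
have zu : z = \sum_(i < n.+1) a i *: u i.
  apply/eqP; rewrite -subr_eq0 -sumrB -[X in _ == X]Ha; apply/eqP.
  by apply: eq_bigr => i _; rewrite scalerBr.
have z_le : nr z <= nrc (a i0) / 2.
  rewrite zu; apply: (le_trans (nr_sum _ _ _)).
  apply: le_trans (_ : \sum_(i < n.+1) nrc (a i0) * (C * eps) <= _).
    apply: ler_sum => i _; rewrite nrZ.
    have [_ h] := Hu i (ltn_ord i).
    by apply: ler_pM h; rewrite ?nrc_ge0 ?nr_ge0//; exact: (Hi0 i (ltn_ord i)).
  rewrite sumr_const card_ord le_eqVlt; apply/orP; left; apply/eqP.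
  by rewrite -[LHS]mulr_natr -mulrA; congr (_ * _); exact: ce.
have [y1 _ pi0 py pyj] := yp i0 i0n'.
have pz : M (p i0) z = a i0 *: y i0.
  rewrite /z linear_sum (bigD1 (Ordinal i0n'))//= big1 ?addr0.
    by rewrite linearZ/= py.
  move=> j jn; rewrite linearZ/=.
  have -> : M (p i0) (y j) = 0.
    apply: pyj => //; apply: contra jn => /eqP ji; apply/eqP/val_inj; exact: ji.
  by rewrite scaler0.
have : nr (M (p i0) z) <= 1 * nr z by apply: (ws_M_le ws).
by rewrite pz nrZ y1; lra.
Qed.

Lemma sigma2E w : seq_complete (Y := Y) -> sigma2 (V * M w) = [set l | peak_orbit phi psi w l].
Proof.
move=> Yc; apply/seteqP; split=> l /=; last exact: peak_sigma2.
by move=> s2; apply: contrapT => np; exact: no_peak_sigma2 Yc np s2.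
Qed.

Lemma sigma_apE w : sigma_ap (V * M w) = [set l | peak_orbit phi psi w l].
Proof.
apply/seteqP; split=> l /=.
  move=> [x [x1 /cvgrPdist_le xl]]; apply: contrapT => np.
  have [C C0 HC] := no_peak_bounded_below ws np.
  have d0 : 0 < (2 * C)^-1 by rewrite invr_gt0 mulr_gt0.
  have [|n _ /(_ n (leqnn n))] := xl (2 * C)^-1%:C; first by rewrite ltcR.
  rewrite /= sub0r opprB -nr_le => h.
  have xn : nr (x n) = 1 by rewrite /nr x1.
  have := HC (x n); rewrite xn => h1.
  have : C * nr (l *: x n - (V * M w) (x n)) <= C * (2 * C)^-1 by rewrite ler_pM2l.
  have -> : C * (2 * C)^-1 = 2^-1 by field; rewrite gt_eqF.
  lra.
move=> /(peak_approx_family ws nper niso) fam.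
have /choice[x Hx] : forall n : nat, exists x, nr x = 1 /\
    nr (l *: x - (V * M w) x) <= n.+1%:R^-1.
  move=> n; have [|y [p /(_ 0 isT)[h1 h2 _ _ _]]] := fam n.+1%:R^-1 1%N.
    by rewrite invr_gt0 ltr0n.
  by exists (y 0).
exists x; split=> [n|]; first by rewrite nrE (Hx n).1.
apply/cvgrPdist_le => d d0.
have dE : d = (complex.Re d)%:C by rewrite RRe_real// gtr0_real.
have d'0 : 0 < complex.Re d by rewrite -ltcR -dE.
apply: filterS (near_natSinv d'0) => n hn.
rewrite sub0r opprB dE -nr_le; apply: le_trans (ltW hn).
exact: (Hx n).2.
Qed.

(** The base point moves one step along its own orbit. This compensates for the weight being carried
    across [U1]. *)
Lemma peak_orbit_comp w l : peak_orbit phi psi (cts_comp w phi) l <-> peak_orbit phi psi w l.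
Proof.
have comm n k : phi (iter n psi k) = iter n psi (phi k).
  elim: n k => // n IH k; rewrite !iterSr IH.
  by rewrite (ws_psiK ws) (ws_phiK ws).
split=> -[k Hk].
  by exists (phi k) => n; have := Hk n; rewrite !cocycle_comp comm.
exists (psi k) => n; rewrite !cocycle_comp comm (ws_psiK ws); exact: Hk.
Qed.

End FredholmSpectrum.

(** * Adjoint operators *)

Section Adjoints.
Context {R : realType} {V : normedModType R[i]}.
Implicit Types A B : 'L(V).

Lemma adjointM A B : adjoint (A * B) = adjoint B * adjoint A.
Proof. by apply: bopP => g; apply: bopP. Qed.

Lemma adjoint1 : adjoint (1 : 'L(V)) = 1.
Proof. by apply: bopP => g; apply: bopP. Qed.

Lemma adjointX A n : adjoint (A ^+ n) = adjoint A ^+ n.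
Proof.
elim: n => [|n IH]; first by rewrite !expr0 adjoint1.
by rewrite exprS adjointM IH -exprSr.
Qed.

Lemma adjointP (a : R[i]) A B : adjoint (a *: A + B) = a *: adjoint A + adjoint B.
Proof. by apply: bopP => g; apply: bopP => x; exact: linearP. Qed.

Lemma nr_adjoint A : nr (adjoint A) <= nr A.
Proof.
apply: bop_nr_le => [|g]; first exact: nr_ge0.
apply: bop_nr_le => [|x]; first by rewrite mulr_ge0 ?nr_ge0.
apply: (le_trans (bop_nr g (A x))).
by rewrite [nr A * _]mulrC -mulrA ler_wpM2l ?nr_ge0// bop_nr.
Qed.

(** Hahn-Banach enters here: it makes the action of [C(K)] on the dual injective, which provides
    vectors supported in any nonempty clopen set. *)
Lemma adjoint_eq0 A : adjoint A = 0 -> A = 0.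
Proof.
move=> A0; apply: bopP => x; apply: contrapT => /dual_separates[g]; apply.
by rewrite -[LHS]/(adjoint A g x) A0.
Qed.

End Adjoints.

(** * Growth of the powers of [U] and its inverse *)

Section SpectrumGrowth.
Context {R : realType} {V : normedModType R[i]} (U U1 : 'L(V)).
Hypotheses (U1U : U1 * U = 1) (UU1 : U * U1 = 1).
Hypothesis spectrum_U : spectrum U `<=` [set z : R[i] | `|z| = 1].
Local Open Scope complex_scope.

Lemma off_circle_inverse (z : R[i]) : nrc z <> 1 ->
  exists B, inverse_bop B (z *: (1 : 'L(V)) - U).
Proof.
move=> z1; apply: contrapT => nB; apply: z1.
have /= : [set z : R[i] | `|z| = 1] z by apply: spectrum_U.
by rewrite nrcE => /complexI.
Qed.

Lemma U_growth : subexponential (fun n => nr (U ^+ n)).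
Proof.
apply: growth_bound => z z1; have [->|z0] := eqVneq z 0.
  by exists 1; rewrite scale0r subr0; split; rewrite mul1r.
have zp : 0 < nrc z by rewrite lt0r nrc_ge0 nrc_eq0 z0.
have [|B [B1 B2]] := @off_circle_inverse z^-1.
  rewrite nrcV => z1'; have : 1 < (nrc z)^-1 by rewrite invf_gt1.
  by rewrite z1' ltxx.
exists (z^-1 *: B).
have -> : 1 - z *: U = z *: (z^-1 *: (1 : 'L(V)) - U).
  by rewrite scalerBr scalerA divff// scale1r.
by split; rewrite bop_scalel bop_scaler scalerA ?B1 ?B2 ?divff ?mulVf// scale1r.
Qed.

(** [1 - z U^-1 = - (z - U) U^-1], so the inverse is governed by the resolvent of [U] inside the
    circle, where [U_growth] relies on the outside. *)
Lemma U1_growth : subexponential (fun n => nr (U1 ^+ n)).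
Proof.
apply: growth_bound => z z1.
have [|B [B1 B2]] := @off_circle_inverse z; first by move=> z1'; rewrite z1' ltxx in z1.
exists (- (U * B)).
have -> : 1 - z *: U1 = - ((z *: (1 : 'L(V)) - U) * U1).
  by rewrite mulrBl UU1 bop_scalel mul1r opprB.
split; rewrite mulrNN.
  by rewrite -mulrA (mulrA B) B1 mul1r.
by rewrite -mulrA (mulrA U1) U1U mul1r.
Qed.

End SpectrumGrowth.

(** * The module and its dual as weighted settings *)

Section Settings.
Context {R : realType} {K : topologicalType} {X : normedModType R[i]}.
Local Notation CK := (continuousType K R[i]^o).
Variables (m : {linear CK -> 'L(X)}) (U U1 : 'L(X)) (phi psi : continuousType K K).
Hypotheses (X_Kaplansky : Kaplansky_module m) (U1U : U1 * U = 1) (UU1 : U * U1 = 1).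
Hypothesis spectrum_U : spectrum U `<=` [set z : R[i] | `|z| = 1].
Hypotheses (phiK : cancel phi psi) (psiK : cancel psi phi).
Hypothesis phiU : forall f : CK, U * m f * U1 = m (cts_comp f phi).
Local Open Scope complex_scope.

Let X_CK : Banach_CK_module m := Kaplansky_Banach_CK_module X_Kaplansky.

Lemma module_nr_le (f : CK) (b : R) : 0 <= b -> (forall k, nrc (f k) <= b) -> nr (m f) <= b.
Proof.
move=> b0 fb; rewrite nr_le (module_isometric X_CK) lecR.
rewrite /sup_norm; set A := [set _ | _ in _].
(* For an empty [K] the supremum takes its default value 0, which the hypothesis [0 <= b] covers. *)
have [A0|A0] := pselect (A !=set0); last first.
  by rewrite (_ : A = set0) ?sup0//; apply/eqP; apply: contra_notT A0 => /set0P.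
by apply: ge_sup => // _ [k _ <-]; exact: fb.
Qed.

Lemma m_commute (f : CK) : m f * U1 = U1 * m (cts_comp f phi).
Proof. by rewrite -phiU !mulrA U1U mul1r. Qed.

Lemma module_setting : weighted_setting phi psi m U1 U.
Proof.
have [m1 mM] := module_morphism X_CK.
split=> //.
- exact: module_compact X_CK.
- exact: module_hausdorff X_CK.
- exact: Kaplansky_extremally_disconnected X_Kaplansky.
- by move=> a f g; rewrite linearP.
- move=> f b y b0 fb; apply: (le_trans (bop_nr _ _)).
  by rewrite ler_wpM2r ?nr_ge0// module_nr_le.
- by move=> f mf0; apply: (module_injective X_CK); rewrite mf0 linear0.
- exact: m_commute.
- exact: U1_growth U1U UU1 spectrum_U.
- exact: U_growth spectrum_U.
Qed.

Lemma adjoint_growth (A : 'L(X)) : subexponential (fun n => nr (A ^+ n)) ->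
  subexponential (fun n => nr (adjoint A ^+ n)).
Proof.
move=> H rho rho1; have [C C0 HC] := H rho rho1; exists C => // n.
by rewrite -adjointX (le_trans (nr_adjoint _)).
Qed.

Lemma dual_setting :
  weighted_setting phi psi (fun f => adjoint (m f)) (adjoint U) (adjoint U1).
Proof.
have [m1 mM] := module_morphism X_CK.
split=> //.
- exact: module_compact X_CK.
- exact: module_hausdorff X_CK.
- exact: Kaplansky_extremally_disconnected X_Kaplansky.
- by rewrite m1 adjoint1.
- by move=> f g; rewrite -adjointM -mM mulrC.
- by move=> a f g; rewrite linearP adjointP.
- move=> f b y b0 fb; apply: (le_trans (bop_nr _ _)).
  by rewrite ler_wpM2r ?nr_ge0// (le_trans (nr_adjoint _))// module_nr_le.
- move=> f /adjoint_eq0 mf0; apply: (module_injective X_CK).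
  by rewrite mf0 linear0.
- by rewrite -adjointM U1U adjoint1.
- by rewrite -adjointM UU1 adjoint1.
- move=> f; rewrite -!adjointM -phiU -!mulrA U1U mulr1//.
- exact/adjoint_growth/(U_growth spectrum_U).
- exact/adjoint_growth/(U1_growth U1U UU1 spectrum_U).
Qed.

End Settings.

Theorem theorem5p10 (R : realType) (K : topologicalType)
    (X : completeNormedModType R[i])
    (m : {linear continuousType K R[i]^o -> 'L(X)})
    (X_Kaplansky : Kaplansky_module m)
    (U U1 : 'L(X)) (U_d_isomorphism : d_isomorphism m U)
    (U1U : U1 * U = 1) (UU1 : U * U1 = 1)
    (spectrum_U : spectrum U `<=` [set z : R[i] | `|z| = 1])
    (w : continuousType K R[i]^o)
    (phi : continuousType K K) (phi_homeo : homeomorphism phi)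
    (phiU : forall f : continuousType K R[i]^o,
      U * m f * U1 = m (cts_comp f phi))
    (phi_periodic : periodic_points phi = set0)
    (K_isolated : isolated [set: K] = set0) :
  sigma2 (adjoint (m w * U)) = sigma_ap (m w * U1).
Proof.
have [_ [psi' [psi_cts phiK' psiK']]] := phi_homeo.
pose psi_c := @isContinuous.Build K K psi' psi_cts.
pose psi : continuousType K K := HB.pack psi' psi_c.
have phiK : cancel phi psi := phiK'.
have psiK : cancel psi phi := psiK'.
have wsX := module_setting X_Kaplansky U1U UU1 spectrum_U phiK psiK phiU.
have wsX' := dual_setting X_Kaplansky U1U UU1 spectrum_U phiK psiK phiU.
(* On [X] the operator becomes [U1] times the weight [w o phi], on the dual [U'] times [w]; the two
   peak conditions agree. *)
rewrite (m_commute U1U phiU) (sigma_apE wsX phi_periodic K_isolated).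
rewrite adjointM (sigma2E wsX' phi_periodic K_isolated); last exact: dual_complete.
by apply/seteqP; split=> l /= /(peak_orbit_comp wsX).
Qed.
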